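(* For small $\alpha>0$, there exist two independent solutions $\psi_+(y,c)$ and $\psi_-(y,c)$ of the Rayleigh equation $$(U_s(y)-c)\bigl(\partial_y^2 \psi - \alpha^2 \psi\bigr) - U_s''(y)\,\psi = 0,$$ defined on $\mathbb{R}^+$, with unit Wronskian, such that $\psi_\pm(y,c) = O(e^{\pm|\alpha| y})$ as $y \to +\infty$. Moreover, for small $\alpha$ and $c$, $$\frac{\partial_y\psi_-(0,c)}{\psi_-(0,c)} = -\frac{U_s'(0)}{c} - \frac{\alpha}{c^2}(U_+-c)^2 + \frac{\alpha^2}{c^2}(U_+-c)^4\,\Omega_0(0,c) + O\Bigl(\frac{\alpha^3}{c^2}\Bigr),$$ where $$\Omega_0(0,c) = -\frac{1}{(U_+-c)^2}\int_0^{+\infty}\Bigl[\frac{(U_s(z)-c)^2}{(U_+-c)^2} - \frac{(U_+-c)^2}{(U_s(z)-c)^2}\Bigr]\,dz .$$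
   Context: $U_s$ is a real-valued $C^\infty$ function on $\mathbb{R}^+=[0,+\infty)$ with $U_s(0)=0$, converging exponentially fast as $y\to+\infty$, together with its first two derivatives, to its limit: $U_s(y)\to U_+$, and the derivatives tend to $0$. The parameter $\alpha$ is real and positive, and $c$ is a complex parameter. In the expansion, $c$ is nonzero and such that the quantities written are defined ($c\neq U_+$ and $U_s(z)\neq c$ for $z\ge 0$). The Wronskian of $\psi_-$ and $\psi_+$ is taken with respect to $y$.
   Formalization: The constant in O(α³/c²) and the smallness of α may depend on a lower bound for |U_s(z)−c| (a bound uniform as c→0 is false, e.g. U_s=1−e^{−y}, c=−ε), and existence of ψ_± is stated only for c≠0, c≠U_+ and c outside the range of U_s. *)

(* Defs.v *)
From Stdlib Require Import Reals.
From Coquelicot Require Import Coquelicot.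

Open Scope R_scope.

(* Derivative relative to the closed half-line [0,+oo): this is [is_derive]
   with the filter [locally y] restricted to [0,+oo), hence the ordinary
   derivative for y > 0 and the right derivative for y = 0. *)
Definition is_derive_Rplus {V : NormedModule R_AbsRing}
    (f : R -> V) (y : R) (l : V) : Prop :=
  filterdiff f (within (fun x => 0 <= x) (locally y)) (fun h : R => scal h l).

(* [f] is C^infinity on [0,+oo), with n-th derivative [D n] there. *)
Definition smooth_Rplus (f : R -> R) (D : nat -> R -> R) : Prop :=
  (forall y, 0 <= y -> D 0%nat y = f y) /\
  (forall (n : nat) y, 0 <= y -> is_derive_Rplus (D n) y (D (S n) y)).

Record shear_profile (Us : R -> R) (dU : nat -> R -> R) (Uplus : R) : Prop := {
  profile_smooth : smooth_Rplus Us dU;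
  profile_at_0 : Us 0 = 0;
  profile_decay : exists K eta : R, 0 < eta /\ forall y, 0 <= y ->
    Rabs (Us y - Uplus) <= K * exp (- eta * y) /\
    Rabs (dU 1%nat y) <= K * exp (- eta * y) /\
    Rabs (dU 2%nat y) <= K * exp (- eta * y)
}.

(* The values of the spectral parameter for which the Rayleigh equation is
   regular on [0,+oo) and at infinity. *)
Definition admissible (Us : R -> R) (Uplus : R) (c : C) : Prop :=
  c <> RtoC 0 /\ c <> RtoC Uplus /\ forall z, 0 <= z -> RtoC (Us z) <> c.

Definition Rayleigh_solution (Us : R -> R) (dU : nat -> R -> R)
    (alpha : R) (c : C) (psi dpsi : R -> C) : Prop :=
  forall y, 0 <= y ->
    is_derive_Rplus (V := C_R_NormedModule) psi y (dpsi y) /\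
    exists d2psi : C,
      is_derive_Rplus (V := C_R_NormedModule) dpsi y d2psi /\
      ((Us y - c) * (d2psi - RtoC alpha ^ 2 * psi y)
         - RtoC (dU 2%nat y) * psi y = RtoC 0)%C.

Definition independent_Rplus (f g : R -> C) : Prop :=
  forall a b : C,
    (forall y, 0 <= y -> (a * f y + b * g y = RtoC 0)%C) ->
    a = RtoC 0 /\ b = RtoC 0.

Definition Wronskian (f df g dg : R -> C) (y : R) : C :=
  (f y * dg y - df y * g y)%C.

Definition bigO_infty (f : R -> C) (g : R -> R) : Prop :=
  exists M : R, Rbar_locally p_infty (fun y => Cmod (f y) <= M * g y).

Definition Omega0_integrand (Us : R -> R) (Uplus : R) (c : C) (z : R) : C :=
  ((Us z - c) ^ 2 / (Uplus - c) ^ 2 - (Uplus - c) ^ 2 / (Us z - c) ^ 2)%C.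

Definition Omega0_integrable (Us : R -> R) (Uplus : R) (c : C) : Prop :=
  ex_RInt_gen (V := C_R_NormedModule) (Omega0_integrand Us Uplus c)
    (at_point 0) (Rbar_locally p_infty).

Definition Omega0_at_0 (Us : R -> R) (Uplus : R) (c : C) : C :=
  (- (RtoC 1 / (Uplus - c) ^ 2) *
    RInt_gen (V := C_R_CompleteNormedModule) (Omega0_integrand Us Uplus c)
      (at_point 0) (Rbar_locally p_infty))%C.

Definition log_derivative_expansion (Us : R -> R) (dU : nat -> R -> R)
    (Uplus alpha : R) (c : C) : C :=
  (- (RtoC (dU 1%nat 0) / c)
   - alpha / c ^ 2 * (Uplus - c) ^ 2
   + RtoC alpha ^ 2 / c ^ 2 * (Uplus - c) ^ 4 * Omega0_at_0 Us Uplus c)%C.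

(* Main.v *)
Require Import Defs.
From Stdlib Require Import Reals Lra Lia Classical IndefiniteDescription.
From Coquelicot Require Import Coquelicot.

Open Scope R_scope.

(** Write [F = U_s - c], with limit [F+] at infinity. In the unknown [psi / F]
    the Rayleigh equation is [(F^2 (psi / F)')' = alpha^2 F^2 (psi / F)], and
    with [psi = F exp (- alpha y) m] it becomes
    [(F^2 exp (- 2 alpha y) m')' = 2 alpha F F' exp (- 2 alpha y) m].
    The right-hand side carries a factor [alpha] and the exponentially small
    [F'], so the solution with [m -> 1] at infinity is the fixed point of a
    Volterra operator ([Jost_solution]); it exists for every [alpha > 0] because
    a suitable weight makes that operator a contraction
    ([weighted_fixed_point]). This gives the decaying solution, with
    [m = 1 + O(alpha)] and [m' = O(alpha exp (- eta y))].

    The decaying solution may vanish at finite [y] (at [y = 0] when [c] is an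
    eigenvalue), so the second solution is not obtained by reduction of order.
    It is the solution of an initial value problem at [y = 0]
    ([unit_Wronskian_partner]), and its growth is read off from
    [(g / f)' = 1 / f^2] for large [y], where [f] has no zero
    ([partner_growth]).

    For the expansion, [H = F^2 (psi / F)' / (alpha psi / F)] solves the Riccati
    equation [H' = alpha (F^2 - H^2 / F^2)] and tends to [- F+^2]. The difference
    [h = H + F+^2] is [O(exp (- eta y))]; the equation then makes [h'], and with
    it [h], of order [alpha] ([defect_first_order]). A second use of the
    equation gives [h' = alpha (F^2 - F+^4 / F^2) + O(alpha^2 exp (- eta y))]
    ([defect_second_order]), and the integral of [F^2 - F+^4 / F^2] over the
    half-line is [- F+^4 Omega_0]. The expansion follows since
    [psi' / psi = F' / F + alpha H / F^2], with [F = - c] at [y = 0]. *)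

(** * Complex-valued functions of a real variable *)

Notation is_derive_C := (is_derive (V := C_R_NormedModule)).
Notation continuous_C := (@continuous R_UniformSpace C_UniformSpace).

Lemma is_derive_C_Re (f : R -> C) (y : R) (l : C) :
  is_derive_C f y l -> is_derive (fun x => fst (f x)) y (fst l).
Proof.
  intros H; unfold is_derive in *.
  apply (filterdiff_comp' f (fst : C -> R) y
    (fun h : R => scal (V := C_R_NormedModule) h l)
    (fst : C_R_NormedModule -> R_NormedModule)); auto.
  apply filterdiff_linear, is_linear_fst.
Qed.

Lemma is_derive_C_Im (f : R -> C) (y : R) (l : C) :
  is_derive_C f y l -> is_derive (fun x => snd (f x)) y (snd l).
Proof.
  intros H; unfold is_derive in *.
  apply (filterdiff_comp' f (snd : C -> R) y
    (fun h : R => scal (V := C_R_NormedModule) h l)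
    (snd : C_R_NormedModule -> R_NormedModule)); auto.
  apply filterdiff_linear, is_linear_snd.
Qed.

Lemma is_derive_C_pair (f : R -> C) (y : R) (l : C) :
  is_derive (fun x => fst (f x)) y (fst l) ->
  is_derive (fun x => snd (f x)) y (snd l) -> is_derive_C f y l.
Proof.
  intros H1 H2; unfold is_derive in *.
  assert (K := @filterdiff_comp'_2 R_AbsRing (AbsRing_NormedModule R_AbsRing)
    R_NormedModule R_NormedModule C_R_NormedModule
    (fun x => fst (f x)) (fun x => snd (f x))
    (fun a b : R => (a, b) : C_R_NormedModule) y _ _ (fun a b => (a, b)) H1 H2).
  apply (@filterdiff_ext_locally R_AbsRing (AbsRing_NormedModule R_AbsRing)
    C_R_NormedModule (fun x => (fst (f x), snd (f x)))).
  - apply filter_forall; intros; symmetry; apply surjective_pairing.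
  - eapply filterdiff_ext_lin.
    + apply K. apply filterdiff_ext with (fun t : C_R_NormedModule => t).
      * intros; apply surjective_pairing.
      * eapply filterdiff_ext_lin; [apply filterdiff_id |].
        intros; apply surjective_pairing.
    + intros; reflexivity.
Qed.

Lemma is_derive_eq (f : R -> R) (y l l' : R) :
  is_derive f y l -> l = l' -> is_derive f y l'.
Proof. now intros H <-. Qed.

Lemma is_derive_C_eq (f : R -> C) (y : R) (l l' : C) :
  is_derive_C f y l -> l = l' -> is_derive_C f y l'.
Proof. now intros H <-. Qed.

Lemma is_derive_C_plus (f g : R -> C) (y : R) (lf lg : C) :
  is_derive_C f y lf -> is_derive_C g y lg ->
  is_derive_C (fun x => f x + g x)%C y (lf + lg)%C.
Proof. apply (is_derive_plus (V := C_R_NormedModule)). Qed.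

Lemma is_derive_C_minus (f g : R -> C) (y : R) (lf lg : C) :
  is_derive_C f y lf -> is_derive_C g y lg ->
  is_derive_C (fun x => f x - g x)%C y (lf - lg)%C.
Proof. apply (is_derive_minus (V := C_R_NormedModule)). Qed.

Lemma is_derive_C_const (a : C) (y : R) : is_derive_C (fun _ => a) y (RtoC 0).
Proof. apply (is_derive_const (V := C_R_NormedModule)). Qed.

Lemma is_derive_C_RtoC (f : R -> R) (y l : R) :
  is_derive f y l -> is_derive_C (fun x => RtoC (f x)) y (RtoC l).
Proof.
  intros H; apply is_derive_C_pair; simpl; [exact H |].
  apply (is_derive_const (V := R_NormedModule)).
Qed.

Lemma is_derive_C_mult (f g : R -> C) (y : R) (lf lg : C) :
  is_derive_C f y lf -> is_derive_C g y lg ->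
  is_derive_C (fun x => f x * g x)%C y (lf * g y + f y * lg)%C.
Proof.
  intros Hf Hg.
  assert (K : forall (u1 u2 v1 v2 : R -> R) (a1 a2 b1 b2 s : R),
    is_derive u1 y a1 -> is_derive u2 y a2 ->
    is_derive v1 y b1 -> is_derive v2 y b2 ->
    is_derive (fun x => u1 x * v1 x + s * (u2 x * v2 x)) y
      (a1 * v1 y + u1 y * b1 + s * (a2 * v2 y + u2 y * b2))).
  { intros u1 u2 v1 v2 a1 a2 b1 b2 s H1 H2 H3 H4.
    auto_derive; [repeat split; eexists; eassumption |].
    replace (Derive (fun x => u1 x) y) with a1
      by (symmetry; now apply is_derive_unique).
    replace (Derive (fun x => u2 x) y) with a2
      by (symmetry; now apply is_derive_unique).
    replace (Derive (fun x => v1 x) y) with b1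
      by (symmetry; now apply is_derive_unique).
    replace (Derive (fun x => v2 x) y) with b2
      by (symmetry; now apply is_derive_unique).
    ring. }
  pose proof (is_derive_C_Re _ _ _ Hf) as f1.
  pose proof (is_derive_C_Im _ _ _ Hf) as f2.
  pose proof (is_derive_C_Re _ _ _ Hg) as g1.
  pose proof (is_derive_C_Im _ _ _ Hg) as g2.
  apply is_derive_C_pair.
  - eapply is_derive_ext; [| eapply is_derive_eq; [apply (K _ _ _ _ _ _ _ _ (-1) f1 f2 g1 g2) |]].
    + intros t; simpl; ring.
    + simpl; ring.
  - eapply is_derive_ext; [| eapply is_derive_eq; [apply (K _ _ _ _ _ _ _ _ 1 f1 f2 g2 g1) |]].
    + intros t; simpl; ring.
    + simpl; ring.
Qed.

Lemma is_derive_C_inv (f : R -> C) (y : R) (lf : C) :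
  is_derive_C f y lf -> f y <> RtoC 0 ->
  is_derive_C (fun x => / f x)%C y (- lf / (f y * f y))%C.
Proof.
  intros Hf Hy.
  assert (N : fst (f y) ^ 2 + snd (f y) ^ 2 <> 0).
  { intros E; apply Hy. rewrite (surjective_pairing (f y)).
    assert (E1 : fst (f y) = 0) by nra. assert (E2 : snd (f y) = 0) by nra.
    now rewrite E1, E2. }
  assert (K : forall (u1 u2 : R -> R) (a1 a2 : R),
    is_derive u1 y a1 -> is_derive u2 y a2 -> u1 y ^ 2 + u2 y ^ 2 <> 0 ->
    is_derive (fun x => u1 x / (u1 x ^ 2 + u2 x ^ 2)) y
      ((a1 * (u2 y ^ 2 - u1 y ^ 2) - 2 * u1 y * u2 y * a2)
         / (u1 y ^ 2 + u2 y ^ 2) ^ 2)).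
  { intros u1 u2 a1 a2 H1 H2 H3.
    auto_derive.
    { repeat split; try (eexists; eassumption). simpl in H3; exact H3. }
    replace (Derive (fun x => u1 x) y) with a1
      by (symmetry; now apply is_derive_unique).
    replace (Derive (fun x => u2 x) y) with a2
      by (symmetry; now apply is_derive_unique).
    field. simpl in *; exact H3. }
  pose proof (is_derive_C_Re _ _ _ Hf) as f1.
  pose proof (is_derive_C_Im _ _ _ Hf) as f2.
  apply is_derive_C_pair.
  - eapply is_derive_eq; [apply (K _ _ _ _ f1 f2 N) |].
    destruct (f y) as [p q], lf as [p' q']; simpl in *. field.
    split; intros E; apply N; nra.
  - assert (N' : snd (f y) ^ 2 + fst (f y) ^ 2 <> 0) by lra.
    eapply is_derive_ext; [| eapply is_derive_eq;
      [apply (is_derive_opp (V := R_NormedModule)), (K _ _ _ _ f2 f1 N') |]].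
    + intros t; unfold opp; simpl. unfold Rdiv.
      rewrite Ropp_mult_distr_l. f_equal. f_equal. ring.
    + destruct (f y) as [p q], lf as [p' q']; unfold opp; simpl in *. field.
      repeat split; intros E; apply N; nra.
Qed.

Lemma is_derive_C_exp (k y : R) :
  is_derive_C (fun x => RtoC (exp (k * x))) y (RtoC k * RtoC (exp (k * y)))%C.
Proof.
  rewrite <- RtoC_mult. apply is_derive_C_RtoC. auto_derive; auto; ring.
Qed.

Lemma continuous_C_pair (f : R -> C) (y : R) :
  continuous (fun x => fst (f x)) y -> continuous (fun x => snd (f x)) y ->
  continuous_C f y.
Proof.
  intros H1 H2.
  assert (K := continuous_comp_2 (X := C_UniformSpace)
    (fun x => fst (f x)) (fun x => snd (f x)) (fun a b : R => (a, b)) y H1 H2).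
  eapply continuous_ext; [| apply K].
  - intros; symmetry; apply surjective_pairing.
  - apply continuous_ext with (fun t : C => t); [| apply continuous_id].
    intros; apply surjective_pairing.
Qed.

Lemma continuous_C_Re (f : R -> C) (y : R) :
  continuous_C f y -> continuous (fun x => fst (f x)) y.
Proof.
  intros H; apply (continuous_comp f (fst : C -> R)); auto.
  destruct (f y); apply continuous_fst.
Qed.

Lemma continuous_C_Im (f : R -> C) (y : R) :
  continuous_C f y -> continuous (fun x => snd (f x)) y.
Proof.
  intros H; apply (continuous_comp f (snd : C -> R)); auto.
  destruct (f y); apply continuous_snd.
Qed.

Lemma continuous_C_RtoC (f : R -> R) (y : R) :
  continuous f y -> continuous_C (fun x => RtoC (f x)) y.
Proof.
  intros H. apply continuous_C_pair; [exact H | apply continuous_const].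
Qed.

Lemma continuous_C_mult (f g : R -> C) (y : R) :
  continuous_C f y -> continuous_C g y -> continuous_C (fun x => f x * g x)%C y.
Proof.
  intros Hf Hg.
  assert (f1 := continuous_C_Re _ _ Hf). assert (f2 := continuous_C_Im _ _ Hf).
  assert (g1 := continuous_C_Re _ _ Hg). assert (g2 := continuous_C_Im _ _ Hg).
  apply continuous_C_pair; simpl.
  - apply (continuous_minus (V := R_NormedModule));
      now apply (continuous_mult (K := R_AbsRing)).
  - apply (continuous_plus (V := R_NormedModule));
      now apply (continuous_mult (K := R_AbsRing)).
Qed.

Lemma is_derive_C_continuous (f : R -> C) (y : R) (l : C) :
  is_derive_C f y l -> continuous_C f y.
Proof.
  intros H. apply (ex_derive_continuous (V := C_R_NormedModule)). now exists l.
Qed.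

(** Only the direction [u y - u x] has to be watched: the real function
    [Re (conj e * u) - |e| P] with [e = u y - u x] is nonincreasing. *)
Lemma mean_value_C (u : R -> C) (du : R -> C) (P dP : R -> R) (x y : R) :
  x <= y ->
  (forall t, x <= t <= y -> is_derive_C u t (du t)) ->
  (forall t, x <= t <= y -> is_derive P t (dP t)) ->
  (forall t, x <= t <= y -> Cmod (du t) <= dP t) ->
  Cmod (u y - u x) <= P y - P x.
Proof.
  intros Hxy Hu HP Hb.
  set (e := (u y - u x)%C).
  set (phi := fun t => fst e * fst (u t) + snd e * snd (u t) - Cmod e * P t).
  set (dphi := fun t => fst e * fst (du t) + snd e * snd (du t) - Cmod e * dP t).
  assert (D : forall t, x <= t <= y -> is_derive phi t (dphi t)).
  { intros t Ht. unfold phi, dphi.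
    apply (is_derive_minus (V := R_NormedModule)
      (fun t => fst e * fst (u t) + snd e * snd (u t)) (fun t => Cmod e * P t)).
    - apply (is_derive_plus (V := R_NormedModule)
        (fun t => fst e * fst (u t)) (fun t => snd e * snd (u t)));
        apply is_derive_scal;
        [now apply is_derive_C_Re, Hu | now apply is_derive_C_Im, Hu].
    - now apply is_derive_scal, HP. }
  assert (CS : forall z : C, fst e * fst z + snd e * snd z <= Cmod e * Cmod z).
  { intros z. rewrite <- (Cmod_conj e), <- Cmod_mult.
    eapply Rle_trans; [| apply re_le_Cmod].
    eapply Rle_trans; [| apply Rle_abs]. destruct e, z; simpl; lra. }
  destruct (MVT_gen phi x y dphi) as [t [Ht E]].
  - rewrite Rmin_left, Rmax_right by lra. intros t Ht; apply D; lra.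
  - rewrite Rmin_left, Rmax_right by lra. intros t Ht.
    apply continuity_pt_filterlim.
    apply (ex_derive_continuous (V := R_NormedModule)). exists (dphi t); auto.
  - rewrite Rmin_left, Rmax_right in Ht by lra.
    assert (dphi t <= 0).
    { unfold dphi. pose proof (CS (du t)). pose proof (Hb t Ht).
      pose proof (Cmod_ge_0 e). nra. }
    assert (S : phi y - phi x = Cmod e * (Cmod e - (P y - P x))).
    { replace (Cmod e * (Cmod e - (P y - P x)))
        with (Cmod e ^ 2 - Cmod e * (P y - P x)) by ring.
      rewrite Cmod2_alt. unfold phi, Re, Im, e; simpl; ring. }
    destruct (Req_dec (Cmod e) 0) as [Z | Z].
    + rewrite Z. enough (0 <= P y - P x) by lra.
      destruct (MVT_gen P x y dP) as [s [Hs Es]].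
      * rewrite Rmin_left, Rmax_right by lra. intros s Hs; apply HP; lra.
      * rewrite Rmin_left, Rmax_right by lra. intros s Hs.
        apply continuity_pt_filterlim.
        apply (ex_derive_continuous (V := R_NormedModule)). exists (dP s); auto.
      * rewrite Rmin_left, Rmax_right in Hs by lra. rewrite Es.
        pose proof (Hb s Hs). pose proof (Cmod_ge_0 (du s)). nra.
    + pose proof (Cmod_ge_0 e). assert (0 < Cmod e) by lra. nra.
Qed.

(** * Continuity on the half-line *)

(** Clamping the argument at [0] turns continuity relative to the half-line into
    continuity on [R], as needed to differentiate integrals at the endpoint. *)
Definition continuous_Rplus (f : R -> C) : Prop :=
  forall y, continuous_C (fun x => f (Rmax 0 x)) y.

Lemma continuous_Rmax0 (y : R) : continuous (Rmax 0) y.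
Proof.
  apply (continuous_ext (fun x => / 2 * (x + Rabs x))).
  - intros x; unfold Rmax; destruct (Rle_dec 0 x);
      [rewrite Rabs_pos_eq | rewrite Rabs_left]; lra.
  - apply (continuous_scal_r (V := R_NormedModule)).
    apply (continuous_plus (V := R_NormedModule)); [apply continuous_id |].
    apply continuous_Rabs.
Qed.

Lemma continuous_Rplus_of_continuous (f : R -> C) :
  (forall y, 0 <= y -> continuous_C f y) -> continuous_Rplus f.
Proof.
  intros H y. apply continuous_comp; [apply continuous_Rmax0 |].
  apply H, Rmax_l.
Qed.

Lemma continuous_Rplus_mult (f g : R -> C) :
  continuous_Rplus f -> continuous_Rplus g -> continuous_Rplus (fun x => f x * g x)%C.
Proof. intros Hf Hg y. now apply continuous_C_mult. Qed.

Lemma ball_Cmod (x y : C) (e : R) :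
  Cmod (y - x) < e -> ball (M := C_UniformSpace) x e y.
Proof. apply C_NormedModule_mixin_compat1. Qed.

Lemma Cmod_ball (x y : C) (e : posreal) :
  ball (M := C_UniformSpace) x e y -> Cmod (y - x) < 2 * e.
Proof.
  intros H. apply C_NormedModule_mixin_compat2 in H.
  eapply Rlt_le_trans; [exact H |]. apply Rmult_le_compat_r; [apply Rlt_le, e |].
  rewrite <- (sqrt_square 2) at 2 by lra. apply sqrt_le_1; lra.
Qed.

Lemma Cmod_minus_sym (x y : C) : Cmod (x - y) = Cmod (y - x).
Proof. rewrite <- Cmod_opp. f_equal. ring. Qed.

Lemma Cmod_triangle_minus (x y z : C) : Cmod (x - z) <= Cmod (x - y) + Cmod (y - z).
Proof.
  replace (x - z)%C with ((x - y) + (y - z))%C by ring. apply Cmod_triangle.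
Qed.

Lemma Cmod_exp (x : R) : Cmod (RtoC (exp x)) = exp x.
Proof. rewrite Cmod_R. apply Rabs_pos_eq, Rlt_le, exp_pos. Qed.

(** The approximation may depend on [r], which is all that a weight growing at
    infinity provides. *)
Lemma continuous_Rplus_uniform_limit (f : R -> C) :
  (forall r e, 0 < e -> exists g, continuous_Rplus g /\
     forall y, 0 <= y <= r -> Cmod (f y - g y) <= e) ->
  continuous_Rplus f.
Proof.
  intros H y. apply (filterlim_locally (F := locally y)
    (fun x => f (Rmax 0 x) : C_UniformSpace)).
  intros [e He]. destruct (H (Rmax 0 y + 1) (e / 8)) as [g [Cg Hg]]; [lra |].
  specialize (Cg y). unfold continuous in Cg.
  pose proof (proj1 (filterlim_locally (U := C_UniformSpace) _ _) Cg
    (mkposreal (e / 8) ltac:(lra))) as L.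
  assert (L1 : locally y (fun x => Rmax 0 x <= Rmax 0 y + 1)).
  { exists (mkposreal 1 ltac:(lra)). intros x Hx.
    change (Rabs (x - y) < 1) in Hx. apply Rabs_def2 in Hx.
    unfold Rmax; destruct (Rle_dec 0 x), (Rle_dec 0 y); lra. }
  generalize (filter_and _ _ L L1). apply filter_imp.
  intros x [B Hx]. apply Cmod_ball in B. cbn [pos] in B.
  apply ball_Cmod. cbn [pos].
  pose proof (Hg (Rmax 0 x) (conj (Rmax_l _ _) Hx)) as A1.
  assert (A2 := Hg (Rmax 0 y) ltac:(pose proof (Rmax_l 0 y); lra)).
  pose proof (Cmod_triangle_minus (f (Rmax 0 x)) (g (Rmax 0 x)) (f (Rmax 0 y))).
  pose proof (Cmod_triangle_minus (g (Rmax 0 x)) (g (Rmax 0 y)) (f (Rmax 0 y))).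
  rewrite (Cmod_minus_sym (f (Rmax 0 y))) in A2. lra.
Qed.

(** * Antiderivatives on the half-line *)

Definition prim (g : R -> C) (y : R) : C :=
  RInt (V := C_R_CompleteNormedModule) (fun x => g (Rmax 0 x)) 0 y.

(** The integral of [g] from [y] to infinity, written so that its derivative is
    the derivative of [prim g]. *)
Definition tail (g : R -> C) (y : R) : C :=
  (RInt_gen (V := C_R_CompleteNormedModule) g (at_point 0) (Rbar_locally p_infty)
     - prim g y)%C.

Lemma prim_is_RInt (g : R -> C) (y : R) :
  continuous_Rplus g ->
  is_RInt (V := C_R_NormedModule) (fun x => g (Rmax 0 x)) 0 y (prim g y).
Proof.
  intros Cg. apply (RInt_correct (V := C_R_CompleteNormedModule)).
  apply (ex_RInt_continuous (V := C_R_CompleteNormedModule)). intros z _; apply Cg.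
Qed.

Lemma prim_derive (g : R -> C) (y : R) :
  continuous_Rplus g -> 0 <= y -> is_derive_C (prim g) y (g y).
Proof.
  intros Cg Hy. rewrite <- (Rmax_right 0 y Hy) at 2.
  apply (is_derive_RInt (V := C_R_NormedModule) (fun x => g (Rmax 0 x)) (prim g) 0).
  - apply filter_forall. intros z. now apply prim_is_RInt.
  - apply Cg.
Qed.

Lemma prim_0 (g : R -> C) : prim g 0 = RtoC 0.
Proof. apply (RInt_point (V := C_R_CompleteNormedModule)). Qed.

Lemma exp_le (x y : R) : x <= y -> exp x <= exp y.
Proof. intros [H | ->]; [left; now apply exp_increasing | lra]. Qed.

Lemma is_derive_exp_scaled (k s y : R) :
  is_derive (fun x => s * exp (k * x)) y (s * k * exp (k * y)).
Proof. auto_derive; auto; ring. Qed.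

Lemma exp_decay_small (s eta e y : R) :
  0 < eta -> 0 < e -> exists z, y <= z /\ 0 <= z /\ s * exp (- eta * z) < e.
Proof.
  intros Heta He. set (z := Rmax (Rmax 0 y) (Rabs s / (eta * e))).
  assert (Z0 : 0 <= z) by (unfold z; eapply Rle_trans; [apply (Rmax_l 0 y) | apply Rmax_l]).
  exists z; repeat split; auto.
  { unfold z; eapply Rle_trans; [apply (Rmax_r 0 y) | apply Rmax_l]. }
  assert (Hz : Rabs s <= eta * e * z).
  { assert (H : Rabs s / (eta * e) <= z) by apply Rmax_r.
    apply (Rmult_le_compat_l (eta * e)) in H; [| nra].
    replace (eta * e * (Rabs s / (eta * e))) with (Rabs s) in H; [lra |].
    field; lra. }
  assert (E : exp (- eta * z) * exp (eta * z) = 1).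
  { rewrite <- exp_plus. replace (- eta * z + eta * z) with 0 by ring. apply exp_0. }
  pose proof (exp_ineq1_le (eta * z)) as I.
  pose proof (exp_pos (- eta * z)) as P.
  pose proof (Rle_abs s).
  assert (s * exp (- eta * z) <= eta * e * z * exp (- eta * z)) by nra.
  assert (exp (- eta * z) * (1 + eta * z) <= 1) by nra. nra.
Qed.

(** Comparison with [P] between [y] and a far point [z], where [u] is negligible. *)
Lemma compare_at_infinity (u du : R -> C) (P dP : R -> R) (s eta : R) :
  0 < eta ->
  (forall t, 0 <= t -> is_derive_C u t (du t)) ->
  (forall t, 0 <= t -> is_derive P t (dP t)) ->
  (forall t, 0 <= t -> Cmod (du t) <= - dP t) ->
  (forall t, 0 <= t -> 0 <= P t) ->
  (forall t, 0 <= t -> Cmod (u t) <= s * exp (- eta * t)) ->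
  forall y, 0 <= y -> Cmod (u y) <= P y.
Proof.
  intros Heta Hu HP Hb P0 Hs y Hy. apply Rle_plus_epsilon. intros e He.
  destruct (exp_decay_small s eta e y Heta He) as [z [Hz [Hz0 Sz]]].
  assert (M : Cmod (u z - u y) <= - P z - - P y).
  { apply (mean_value_C u du (fun t => - P t) (fun t => - dP t) y z); auto.
    - intros t Ht. apply Hu; lra.
    - intros t Ht. apply (is_derive_opp (V := R_NormedModule)), HP; lra.
    - intros t Ht; apply Hb; lra. }
  pose proof (Hs z Hz0). pose proof (P0 z Hz0).
  rewrite Cmod_minus_sym in M.
  pose proof (Cmod_triangle (u y - u z) (u z)) as T.
  replace (u y - u z + u z)%C with (u y) in T by ring. lra.
Qed.

Lemma compare_exp (u du : R -> C) (s0 s eta : R) :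
  0 < eta ->
  (forall t, 0 <= t -> is_derive_C u t (du t)) ->
  (forall t, 0 <= t -> Cmod (du t) <= s * exp (- eta * t)) ->
  (forall t, 0 <= t -> Cmod (u t) <= s0 * exp (- eta * t)) ->
  forall y, 0 <= y -> Cmod (u y) <= s / eta * exp (- eta * y).
Proof.
  intros Heta Hu Hd Hs.
  assert (S : 0 <= s).
  { pose proof (Hd 0 (Rle_refl 0)) as H. rewrite Rmult_0_r, exp_0, Rmult_1_r in H.
    pose proof (Cmod_ge_0 (du 0)); lra. }
  apply (compare_at_infinity u du (fun t => s / eta * exp (- eta * t))
    (fun t => s / eta * - eta * exp (- eta * t)) s0 eta); auto.
  - intros; apply is_derive_exp_scaled.
  - intros t Ht. replace (- _) with (s * exp (- eta * t)) by (field; lra). auto.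
  - intros t Ht. apply Rmult_le_pos; [| apply Rlt_le, exp_pos].
    apply Rmult_le_pos; [auto | now apply Rlt_le, Rinv_0_lt_compat].
Qed.

Lemma compare_from_0 (u du : R -> C) (P dP : R -> R) :
  (forall t, 0 <= t -> is_derive_C u t (du t)) ->
  (forall t, 0 <= t -> is_derive P t (dP t)) ->
  (forall t, 0 <= t -> Cmod (du t) <= dP t) ->
  Cmod (u 0) <= P 0 ->
  forall y, 0 <= y -> Cmod (u y) <= P y.
Proof.
  intros Hu HP Hb H0 y Hy.
  assert (M : Cmod (u y - u 0) <= P y - P 0).
  { apply (mean_value_C u du P dP 0 y); auto; intros t Ht;
      [apply Hu | apply HP | apply Hb]; lra. }
  pose proof (Cmod_triangle (u y - u 0) (u 0)) as T.
  replace (u y - u 0 + u 0)%C with (u y) in T by ring. lra.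
Qed.

Lemma prim_increment (g : R -> C) (s eta : R) :
  0 < eta -> continuous_Rplus g ->
  (forall t, 0 <= t -> Cmod (g t) <= s * exp (- eta * t)) ->
  forall y z, 0 <= y <= z -> Cmod (prim g z - prim g y) <= s / eta * exp (- eta * y).
Proof.
  intros Heta Cg Hg y z Hyz.
  assert (S : 0 <= s).
  { pose proof (Hg 0 (Rle_refl 0)) as H. rewrite Rmult_0_r, exp_0, Rmult_1_r in H.
    pose proof (Cmod_ge_0 (g 0)); lra. }
  assert (M : Cmod (prim g z - prim g y)
    <= - (s / eta) * exp (- eta * z) - - (s / eta) * exp (- eta * y)).
  { apply (mean_value_C (prim g) g (fun t => - (s / eta) * exp (- eta * t))
      (fun t => - (s / eta) * - eta * exp (- eta * t)) y z); try lra.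
    - intros t Ht; apply prim_derive; auto; lra.
    - intros; apply is_derive_exp_scaled.
    - intros t Ht. replace (_ * exp (- eta * t)) with (s * exp (- eta * t))
        by (field; lra). apply Hg; lra. }
  assert (0 <= s / eta).
  { apply Rmult_le_pos; [auto | now apply Rlt_le, Rinv_0_lt_compat]. }
  pose proof (exp_pos (- eta * z)). nra.
Qed.

Lemma tail_exists (g : R -> C) (s eta : R) :
  0 < eta -> continuous_Rplus g ->
  (forall t, 0 <= t -> Cmod (g t) <= s * exp (- eta * t)) ->
  exists l : C, is_RInt_gen (V := C_R_NormedModule) g
                  (at_point 0) (Rbar_locally p_infty) l /\
    forall y, 0 <= y -> Cmod (l - prim g y) <= s / eta * exp (- eta * y).
Proof.
  intros Heta Cg Hg.
  destruct (proj1 (filterlim_locally_cauchy (U := C_R_CompleteNormedModule)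
    (F := Rbar_locally p_infty) (prim g))) as [l Hl].
  - intros e. destruct (exp_decay_small (s / eta) eta (e / 2) 0 Heta) as [z [_ [Hz Sz]]];
      [destruct e; simpl; lra |].
    exists (fun y => z < y). split; [now exists z |].
    intros u v Hu Hv. apply ball_Cmod.
    pose proof (prim_increment g s eta Heta Cg Hg z u ltac:(lra)) as A.
    pose proof (prim_increment g s eta Heta Cg Hg z v ltac:(lra)) as B.
    pose proof (Cmod_triangle_minus (prim g v) (prim g z) (prim g u)) as T.
    rewrite (Cmod_minus_sym (prim g z) (prim g u)) in T. lra.
  - exists l. split.
    + intros P HP. specialize (Hl P HP). destruct Hl as [M HM].
      exists (fun a => a = 0) (fun b => Rmax 0 M < b); [reflexivity | now exists (Rmax 0 M) |].
      intros a b -> Hb. exists (prim g b). split.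
      * simpl. apply (is_RInt_ext (fun x => g (Rmax 0 x))); [| now apply prim_is_RInt].
        intros x Hx. rewrite Rmin_left in Hx.
        -- rewrite Rmax_right; [easy | lra].
        -- pose proof (Rmax_l 0 M); lra.
      * apply HM. pose proof (Rmax_r 0 M); lra.
    + intros y Hy. apply Rle_plus_epsilon. intros e He.
      destruct (Hl _ (locally_ball l (mkposreal (e / 2) ltac:(lra)))) as [M HM].
      set (z := Rmax y M + 1).
      assert (y <= z) by (pose proof (Rmax_l y M); unfold z; lra).
      assert (Mz : M < z) by (pose proof (Rmax_r y M); unfold z; lra).
      apply HM in Mz. change (ball (M := C_UniformSpace) l (e / 2) (prim g z)) in Mz.
      apply (Cmod_ball l (prim g z) (mkposreal (e / 2) ltac:(lra))) in Mz.
      cbn [pos] in Mz.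
      pose proof (prim_increment g s eta Heta Cg Hg y z ltac:(lra)).
      pose proof (Cmod_triangle_minus l (prim g z) (prim g y)) as T.
      rewrite (Cmod_minus_sym l (prim g z)) in T. lra.
Qed.

Lemma at_infinity_proper : ProperFilter' (Rbar_locally p_infty).
Proof. apply Proper_StrongProper, Rbar_locally_filter. Qed.

Lemma tail_bound (g : R -> C) (s eta : R) :
  0 < eta -> continuous_Rplus g ->
  (forall t, 0 <= t -> Cmod (g t) <= s * exp (- eta * t)) ->
  is_RInt_gen (V := C_R_NormedModule) g (at_point 0) (Rbar_locally p_infty) (tail g 0) /\
  forall y, 0 <= y -> Cmod (tail g y) <= s / eta * exp (- eta * y).
Proof.
  intros Heta Cg Hg. destruct (tail_exists g s eta Heta Cg Hg) as [l [Hl Bl]].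
  unfold tail. rewrite (is_RInt_gen_unique (V := C_R_CompleteNormedModule) g l Hl).
  split; auto. rewrite prim_0. now replace (l - RtoC 0)%C with l by ring.
Qed.

Lemma tail_derive (g : R -> C) (y : R) :
  continuous_Rplus g -> 0 <= y -> is_derive_C (tail g) y (- g y)%C.
Proof.
  intros Cg Hy. unfold tail. eapply is_derive_C_eq.
  - apply is_derive_C_minus; [apply is_derive_C_const | now apply prim_derive].
  - ring.
Qed.

(** * Fixed points in weighted norms *)

Lemma geometric_null (a s : R) : 0 <= a -> (forall n, a <= s * (/ 2) ^ n) -> a = 0.
Proof.
  intros Ha H. apply Rle_antisym; auto. apply Rle_plus_epsilon. intros e He.
  destruct (pow_lt_1_zero (/ 2) ltac:(rewrite Rabs_pos_eq; lra) (e / (Rabs s + 1)))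
    as [N HN].
  { pose proof (Rabs_pos s). apply Rdiv_lt_0_compat; lra. }
  specialize (HN N (le_n N)). specialize (H N).
  pose proof (Rabs_pos s). pose proof (Rle_abs s).
  assert (0 < (/ 2) ^ N) by (apply pow_lt; lra).
  rewrite Rabs_pos_eq in HN by lra.
  apply (Rmult_lt_compat_l (Rabs s + 1)) in HN; [| lra].
  replace ((Rabs s + 1) * (e / (Rabs s + 1))) with e in HN by (field; lra).
  nra.
Qed.

Lemma geometric_limit (x : nat -> C) (s : R) :
  (forall n, Cmod (x (S n) - x n) <= s * (/ 2) ^ n) ->
  exists l : C, forall n, Cmod (l - x n) <= 2 * s * (/ 2) ^ n.
Proof.
  intros H.
  assert (S0 : 0 <= s).
  { specialize (H 0%nat). pose proof (Cmod_ge_0 (x 1%nat - x 0%nat)). simpl in H; lra. }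
  assert (D : forall k n, Cmod (x (n + k)%nat - x n)
                <= 2 * s * (/ 2) ^ n - 2 * s * (/ 2) ^ (n + k)).
  { induction k; intros n.
    - rewrite Nat.add_0_r. replace (x n - x n)%C with (RtoC 0) by ring.
      rewrite Cmod_0; lra.
    - rewrite Nat.add_succ_r.
      pose proof (Cmod_triangle_minus (x (S (n + k))) (x (n + k)%nat) (x n)).
      pose proof (H (n + k)%nat). specialize (IHk n).
      simpl pow. lra. }
  assert (P : forall n, 0 < (/ 2) ^ n) by (intros; apply pow_lt; lra).
  destruct (proj1 (filterlim_locally_cauchy (U := C_R_CompleteNormedModule)
    (F := eventually) x)) as [l Hl].
  - intros e. destruct (pow_lt_1_zero (/ 2) ltac:(rewrite Rabs_pos_eq; lra)
      (e / (4 * s + 1))) as [N HN].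
    { apply Rdiv_lt_0_compat; [apply e | lra]. }
    assert (HN' : 4 * s * (/ 2) ^ N < e).
    { specialize (HN N (le_n N)). rewrite Rabs_pos_eq in HN by apply Rlt_le, P.
      apply (Rmult_lt_compat_l (4 * s + 1)) in HN; [| lra].
      replace ((4 * s + 1) * (e / (4 * s + 1))) with (pos e) in HN by (field; lra).
      specialize (P N). lra. }
    exists (fun n => (N <= n)%nat). split; [now exists N |].
    intros u v Hu Hv. apply ball_Cmod.
    pose proof (D (u - N)%nat N) as Du. pose proof (D (v - N)%nat N) as Dv.
    replace (N + (u - N))%nat with u in Du by lia.
    replace (N + (v - N))%nat with v in Dv by lia.
    pose proof (Cmod_triangle_minus (x v) (x N) (x u)) as T.
    rewrite (Cmod_minus_sym (x N) (x u)) in T.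
    pose proof (Rmult_le_pos _ _ S0 (Rlt_le _ _ (P u))).
    pose proof (Rmult_le_pos _ _ S0 (Rlt_le _ _ (P v))). lra.
  - exists l. intros n. apply Rle_plus_epsilon. intros e He.
    assert (He2 : 0 < e / 2) by lra.
    destruct (Hl _ (locally_ball l (mkposreal _ He2))) as [M HM].
    specialize (HM (M + n)%nat ltac:(lia)).
    apply (Cmod_ball l _ (mkposreal _ He2)) in HM. cbn [pos] in HM.
    pose proof (D M n) as Dn. rewrite (Nat.add_comm n M) in Dn.
    pose proof (Cmod_triangle_minus l (x (M + n)%nat) (x n)) as T.
    rewrite (Cmod_minus_sym l (x (M + n)%nat)) in T.
    pose proof (Rmult_le_pos _ _ S0 (Rlt_le _ _ (P (M + n)%nat))). lra.
Qed.

Definition controlled (w : R -> R) (f : R -> C) : Prop :=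
  continuous_Rplus f /\ exists k, forall y, 0 <= y -> Cmod (f y) <= k * w y.

Lemma zero_controlled (w : R -> R) : controlled w (fun _ => RtoC 0).
Proof.
  split; [intros y; apply continuous_const |]. exists 0.
  intros y _. rewrite Cmod_0; lra.
Qed.

(** Banach iteration from [0] in the norm [sup |f| / w]. For a Volterra operator
    the weight [w] can be chosen so that the factor is [1 / 2] whatever the size
    of the kernel. *)
Lemma weighted_fixed_point (T : (R -> C) -> R -> C) (w : R -> R) (k0 : R) :
  (forall r, exists W, forall y, 0 <= y <= r -> 0 <= w y <= W) ->
  (forall f, controlled w f -> controlled w (T f)) ->
  (forall f g k, controlled w f -> controlled w g ->
     (forall y, 0 <= y -> Cmod (f y - g y) <= k * w y) ->
     forall y, 0 <= y -> Cmod (T f y - T g y) <= k / 2 * w y) ->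
  (forall y, 0 <= y -> Cmod (T (fun _ => RtoC 0) y) <= k0 * w y) ->
  exists f, controlled w f /\
    (forall y, 0 <= y -> Cmod (f y) <= 2 * k0 * w y) /\
    (forall y, 0 <= y -> f y = T f y).
Proof.
  intros Hw Tc Td T0.
  set (X := fun n => Nat.iter n T (fun _ => RtoC 0)).
  assert (w0 : forall y, 0 <= y -> 0 <= w y).
  { intros y Hy. destruct (Hw y) as [W HW]. apply HW; lra. }
  assert (Xc : forall n, controlled w (X n)).
  { induction n; [apply zero_controlled | now apply (Tc (X n))]. }
  assert (XD : forall n y, 0 <= y ->
    Cmod (X (S n) y - X n y) <= k0 * w y * (/ 2) ^ n).
  { assert (XD : forall n y, 0 <= y ->
      Cmod (X (S n) y - X n y) <= k0 * (/ 2) ^ n * w y).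
    { induction n; intros y Hy.
      - unfold X; simpl. replace (T (fun _ => RtoC 0) y - RtoC 0)%C
          with (T (fun _ => RtoC 0) y) by ring. specialize (T0 y Hy); lra.
      - replace (k0 * (/ 2) ^ S n) with (k0 * (/ 2) ^ n / 2) by (simpl; field).
        now apply (Td (X (S n)) (X n)). }
    intros n y Hy. specialize (XD n y Hy). lra. }
  destruct (functional_choice (fun y l =>
    0 <= y -> forall n, Cmod (l - X n y) <= 2 * (k0 * w y) * (/ 2) ^ n)) as [f Hf].
  { intros y. destruct (Rle_dec 0 y) as [Hy | Hy].
    - destruct (geometric_limit (fun n => X n y) (k0 * w y)) as [l Hl];
        [intros n; now apply XD | now exists l].
    - exists (RtoC 0). intros; contradiction. }
  assert (B : forall y, 0 <= y -> Cmod (f y) <= 2 * k0 * w y).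
  { intros y Hy. pose proof (Hf y Hy 0%nat) as H. unfold X in H; simpl in H.
    replace (f y - RtoC 0)%C with (f y) in H by ring. lra. }
  assert (fc : controlled w f).
  { split; [| now exists (2 * k0)].
    apply continuous_Rplus_uniform_limit. intros r e He.
    destruct (Hw r) as [W HW].
    set (s := 2 * Rabs k0 * Rabs W + 1).
    assert (s1 : 1 <= s).
    { unfold s. pose proof (Rabs_pos k0). pose proof (Rabs_pos W). nra. }
    destruct (pow_lt_1_zero (/ 2) ltac:(rewrite Rabs_pos_eq; lra) (e / s)) as [N HN].
    { apply Rdiv_lt_0_compat; lra. }
    specialize (HN N (le_n N)).
    assert (P : 0 < (/ 2) ^ N) by (apply pow_lt; lra).
    rewrite Rabs_pos_eq in HN by lra.
    apply (Rmult_lt_compat_l s) in HN; [| lra].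
    replace (s * (e / s)) with e in HN by (field; lra).
    exists (X N). split; [apply Xc |]. intros y Hy.
    eapply Rle_trans; [apply Hf; lra |]. apply Rle_trans with (s * (/ 2) ^ N); [| lra].
    apply Rmult_le_compat_r; [lra |]. unfold s.
    specialize (HW y Hy). pose proof (Rle_abs k0). pose proof (Rle_abs W).
    pose proof (Rabs_pos k0).
    assert (k0 * w y <= Rabs k0 * w y) by (apply Rmult_le_compat_r; lra).
    assert (Rabs k0 * w y <= Rabs k0 * Rabs W) by (apply Rmult_le_compat_l; lra).
    lra. }
  exists f. split; [exact fc | split; [exact B |]].
  intros y Hy.
  assert (E : Cmod (f y - T f y) = 0).
  { apply (geometric_null _ (2 * (k0 * w y))); [apply Cmod_ge_0 |]. intros n.
    pose proof (Hf y Hy (S n)) as H1. simpl pow in H1.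
    assert (H2 : Cmod (T (X n) y - T f y) <= 2 * k0 * (/ 2) ^ n / 2 * w y).
    { apply Td; auto. intros z Hz. rewrite Cmod_minus_sym.
      eapply Rle_trans; [now apply Hf |]. lra. }
    pose proof (Cmod_triangle_minus (f y) (X (S n) y) (T f y)) as H3.
    change (X (S n) y) with (T (X n) y) in *. lra. }
  apply Cmod_eq_0 in E. replace (f y) with ((f y - T f y) + T f y)%C by ring.
  rewrite E; ring.
Qed.

(** * The decaying solution *)

(** The equation [(exp (- 2 alpha y) n)' = 2 alpha a exp (- 2 alpha y) m],
    [m' = b n] with [m -> 1] and [n -> 0] at infinity; below, [a = F F'] and
    [b = 1 / F^2]. *)
Section Jost.
Variables (alpha eta A B : R) (a b : R -> C).
Hypothesis alpha_pos : 0 < alpha.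
Hypothesis eta_pos : 0 < eta.
Hypothesis B_nonneg : 0 <= B.
Hypothesis a_cont : continuous_Rplus a.
Hypothesis b_cont : continuous_Rplus b.
Hypothesis a_decay : forall y, 0 <= y -> Cmod (a y) <= A * exp (- eta * y).
Hypothesis b_bounded : forall y, 0 <= y -> Cmod (b y) <= B.

Let L : R := 4 * alpha * A * B / eta ^ 2.
(** Up to a constant, [- w'] is [exp (- eta y) w], the kernel of the integral
    equation applied to [w]; the constant [L] gives the contraction factor. *)
Let w (y : R) : R := exp (L * exp (- eta * y)).

Definition Jost_source (f : R -> C) (y : R) : C :=
  (a y * (RtoC (exp (- (2 * alpha) * y)) * f y))%C.
Definition Jost_flux (f : R -> C) (y : R) : C :=
  (- RtoC (2 * alpha) * (RtoC (exp (2 * alpha * y)) * tail (Jost_source f) y))%C.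
Definition Jost_map (f : R -> C) (y : R) : C :=
  (RtoC 1 - tail (fun z => b z * Jost_flux f z) y)%C.

Lemma source_bound_nonneg : 0 <= A.
Proof.
  pose proof (a_decay 0 (Rle_refl 0)) as H. rewrite Rmult_0_r, exp_0, Rmult_1_r in H.
  pose proof (Cmod_ge_0 (a 0)); lra.
Qed.

Lemma coupling_nonneg : 0 <= L.
Proof.
  pose proof source_bound_nonneg. unfold L. apply Rmult_le_pos.
  - repeat apply Rmult_le_pos; lra.
  - apply Rlt_le, Rinv_0_lt_compat. nra.
Qed.

Lemma weight_bounds (y : R) : 0 <= y -> 1 <= w y <= exp L.
Proof.
  intros Hy. pose proof coupling_nonneg. pose proof (exp_pos (- eta * y)).
  assert (exp (- eta * y) <= 1).
  { rewrite <- exp_0. apply exp_le. nra. }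
  unfold w. split.
  - rewrite <- exp_0. apply exp_le. nra.
  - apply exp_le. nra.
Qed.

Lemma exp_decay_split (y : R) :
  exp (- eta * y) * exp (- (2 * alpha) * y) = exp (- (eta + 2 * alpha) * y).
Proof. rewrite <- exp_plus. f_equal. ring. Qed.

Lemma Jost_source_cont (f : R -> C) : continuous_Rplus f -> continuous_Rplus (Jost_source f).
Proof.
  intros Hf. apply continuous_Rplus_mult; auto. apply continuous_Rplus_mult; auto.
  apply continuous_Rplus_of_continuous. intros y _.
  eapply is_derive_C_continuous, is_derive_C_exp.
Qed.

Lemma Jost_source_decay (f : R -> C) (k : R) :
  (forall y, 0 <= y -> Cmod (f y) <= k * w y) ->
  forall y, 0 <= y ->
    Cmod (Jost_source f y) <= A * (k * exp L) * exp (- (eta + 2 * alpha) * y).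
Proof.
  intros Hf y Hy. unfold Jost_source.
  rewrite !Cmod_mult, Cmod_exp, <- exp_decay_split.
  assert (Cmod (f y) <= k * exp L).
  { specialize (Hf y Hy). pose proof (weight_bounds y Hy). pose proof (Cmod_ge_0 (f y)).
    assert (0 <= k) by nra. nra. }
  replace (A * (k * exp L) * (exp (- eta * y) * exp (- (2 * alpha) * y)))
    with (A * exp (- eta * y) * (exp (- (2 * alpha) * y) * (k * exp L))) by ring.
  apply Rmult_le_compat; auto using Cmod_ge_0.
  - apply Rmult_le_pos; [apply Rlt_le, exp_pos | apply Cmod_ge_0].
  - apply Rmult_le_compat_l; [apply Rlt_le, exp_pos | auto].
Qed.

Lemma Jost_flux_derive (f : R -> C) (y : R) :
  continuous_Rplus f -> 0 <= y ->
  is_derive_C (Jost_flux f) y (RtoC (2 * alpha) * (Jost_flux f y + a y * f y))%C.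
Proof.
  intros Hf Hy. unfold Jost_flux. eapply is_derive_C_eq.
  - apply is_derive_C_mult; [apply is_derive_C_const |].
    apply is_derive_C_mult; [apply is_derive_C_exp |].
    apply tail_derive; auto. now apply Jost_source_cont.
  - unfold Jost_source.
    assert (E : (RtoC (exp (2 * alpha * y)) * RtoC (exp (- (2 * alpha) * y)) = RtoC 1)%C).
    { rewrite <- RtoC_mult, <- exp_plus. f_equal. rewrite <- exp_0. f_equal. ring. }
    set (e1 := RtoC (exp (2 * alpha * y))) in *.
    set (e2 := RtoC (exp (- (2 * alpha) * y))) in *.
    transitivity (RtoC (2 * alpha) * (- RtoC (2 * alpha) *
      (e1 * tail (fun y0 => a y0 * (RtoC (exp (- (2 * alpha) * y0)) * f y0)) y)
      + a y * f y * (e1 * e2)))%C; [ring | rewrite E; ring].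
Qed.

(** [w] is nonincreasing, so it comes out of the integral from [y] to infinity. *)
Lemma Jost_flux_contraction (f g : R -> C) (k : R) :
  controlled w f -> controlled w g ->
  (forall y, 0 <= y -> Cmod (f y - g y) <= k * w y) ->
  forall y, 0 <= y ->
    Cmod (Jost_flux f y - Jost_flux g y) <= 2 * alpha * k * (A / eta) * (w y * exp (- eta * y)).
Proof.
  intros [fc [kf Hf]] [gc [kg Hg]] Hfg y Hy.
  pose proof source_bound_nonneg as A0. pose proof coupling_nonneg as L0.
  assert (k0 : 0 <= k).
  { pose proof (Hfg y Hy). pose proof (weight_bounds y Hy).
    pose proof (Cmod_ge_0 (f y - g y)). nra. }
  assert (Ae : 0 <= A / eta).
  { apply Rmult_le_pos; [auto | now apply Rlt_le, Rinv_0_lt_compat]. }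
  assert (ea : 0 < eta + 2 * alpha) by lra.
  assert (M : Cmod (tail (Jost_source f) y - tail (Jost_source g) y)
     <= k * (A / eta) * (w y * exp (- (eta + 2 * alpha) * y))).
  { apply (compare_at_infinity
      (fun y => tail (Jost_source f) y - tail (Jost_source g) y)%C
      (fun y => - Jost_source f y - - Jost_source g y)%C
      (fun y => k * (A / eta) * (w y * exp (- (eta + 2 * alpha) * y)))
      (fun y => - (k * (A / eta)) * ((L * eta * exp (- eta * y) + (eta + 2 * alpha))
                 * (w y * exp (- (eta + 2 * alpha) * y))))
      (A * (kf * exp L) / (eta + 2 * alpha) + A * (kg * exp L) / (eta + 2 * alpha))
      (eta + 2 * alpha)); auto.
    - intros t Ht. apply is_derive_C_minus; apply tail_derive; auto;
        now apply Jost_source_cont.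
    - intros t Ht. unfold w. auto_derive; auto. ring.
    - intros t Ht. replace (- Jost_source f t - - Jost_source g t)%C
        with (- (a t * (RtoC (exp (- (2 * alpha) * t)) * (f t - g t))))%C
        by (unfold Jost_source; ring).
      rewrite Cmod_opp, !Cmod_mult, Cmod_exp.
      pose proof (weight_bounds t Ht) as W.
      apply Rle_trans with (A * exp (- eta * t) * (exp (- (2 * alpha) * t) * (k * w t))).
      + apply Rmult_le_compat; auto using Cmod_ge_0.
        * apply Rmult_le_pos; [apply Rlt_le, exp_pos | apply Cmod_ge_0].
        * apply Rmult_le_compat_l; [apply Rlt_le, exp_pos | auto].
      + replace (A * exp (- eta * t) * (exp (- (2 * alpha) * t) * (k * w t)))
          with (k * (A / eta) * eta * (w t * exp (- (eta + 2 * alpha) * t)))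
          by (rewrite <- exp_decay_split; field; lra).
        pose proof (exp_pos (- eta * t)). pose proof (exp_pos (- (eta + 2 * alpha) * t)).
        assert (0 <= k * (A / eta)) by nra.
        assert (0 <= w t * exp (- (eta + 2 * alpha) * t)) by nra.
        assert (0 <= L * eta * exp (- eta * t)).
        { apply Rmult_le_pos; [| lra]. apply Rmult_le_pos; lra. }
        assert (0 <= k * (A / eta) * (w t * exp (- (eta + 2 * alpha) * t)))
          by (apply Rmult_le_pos; auto).
        nra.
    - intros t Ht. pose proof (weight_bounds t Ht). pose proof (exp_pos (- (eta + 2 * alpha) * t)).
      apply Rmult_le_pos; [apply Rmult_le_pos; auto |]. apply Rmult_le_pos; lra.
    - intros t Ht. rewrite Rmult_plus_distr_r.
      eapply Rle_trans; [apply Cmod_triangle |]. rewrite Cmod_opp.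
      apply Rplus_le_compat; apply tail_bound; auto using Jost_source_cont, Jost_source_decay. }
  replace (Jost_flux f y - Jost_flux g y)%C with
    (- RtoC (2 * alpha) * (RtoC (exp (2 * alpha * y)) *
       (tail (Jost_source f) y - tail (Jost_source g) y)))%C by (unfold Jost_flux; ring).
  rewrite !Cmod_mult, Cmod_opp, Cmod_exp, Cmod_R, Rabs_pos_eq by lra.
  assert (E : exp (- eta * y) = exp (2 * alpha * y) * exp (- (eta + 2 * alpha) * y)).
  { rewrite <- exp_plus. f_equal. ring. }
  rewrite E.
  replace (2 * alpha * k * (A / eta)
             * (w y * (exp (2 * alpha * y) * exp (- (eta + 2 * alpha) * y))))
    with (2 * alpha * (exp (2 * alpha * y)
            * (k * (A / eta) * (w y * exp (- (eta + 2 * alpha) * y))))) by ring.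
  apply Rmult_le_compat_l; [lra |]. apply Rmult_le_compat_l; [apply Rlt_le, exp_pos | auto].
Qed.

Lemma Jost_flux_zero (y : R) : 0 <= y -> Jost_flux (fun _ => RtoC 0) y = RtoC 0.
Proof.
  intros Hy. unfold Jost_flux.
  enough (E : tail (Jost_source (fun _ => RtoC 0)) y = RtoC 0) by (rewrite E; ring).
  apply Cmod_eq_0, Rle_antisym; [| apply Cmod_ge_0].
  apply Rle_trans with (0 / eta * exp (- eta * y)); [| right; field; lra].
  apply tail_bound; auto.
  - apply Jost_source_cont, (zero_controlled w).
  - intros t Ht. unfold Jost_source.
    replace (a t * (RtoC (exp (- (2 * alpha) * t)) * RtoC 0))%C with (RtoC 0) by ring.
    rewrite Cmod_0; lra.
Qed.

Lemma Jost_flux_bound (f : R -> C) (k : R) :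
  continuous_Rplus f -> (forall y, 0 <= y -> Cmod (f y) <= k * w y) ->
  forall y, 0 <= y ->
    Cmod (Jost_flux f y) <= 2 * alpha * k * (A / eta) * exp L * exp (- eta * y).
Proof.
  intros fc Hf y Hy.
  pose proof (Jost_flux_contraction f (fun _ => RtoC 0) k
    (conj fc (ex_intro _ k Hf)) (zero_controlled w)) as H.
  assert (H1 : forall y, 0 <= y -> Cmod (f y - RtoC 0) <= k * w y).
  { intros z Hz. replace (f z - RtoC 0)%C with (f z) by ring. auto. }
  specialize (H H1 y Hy). rewrite Jost_flux_zero in H by auto.
  replace (Jost_flux f y - RtoC 0)%C with (Jost_flux f y) in H by ring.
  eapply Rle_trans; [exact H |]. pose proof (weight_bounds y Hy).
  assert (0 <= k) by (pose proof (Hf y Hy); pose proof (Cmod_ge_0 (f y)); nra).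
  pose proof source_bound_nonneg.
  assert (0 <= 2 * alpha * k * (A / eta)).
  { repeat apply Rmult_le_pos; try lra. now apply Rlt_le, Rinv_0_lt_compat. }
  rewrite (Rmult_assoc _ (exp L)). apply Rmult_le_compat_l; auto.
  apply Rmult_le_compat_r; [apply Rlt_le, exp_pos | lra].
Qed.

Lemma Jost_integrand_cont (f : R -> C) :
  continuous_Rplus f -> continuous_Rplus (fun z => b z * Jost_flux f z)%C.
Proof.
  intros Hf. apply continuous_Rplus_mult; auto.
  apply continuous_Rplus_of_continuous. intros y Hy.
  eapply is_derive_C_continuous, Jost_flux_derive; auto.
Qed.

Lemma Jost_integrand_bound (f : R -> C) (k : R) :
  continuous_Rplus f -> (forall y, 0 <= y -> Cmod (f y) <= k * w y) ->
  forall y, 0 <= y -> Cmod (b y * Jost_flux f y)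
    <= B * (2 * alpha * k * (A / eta) * exp L) * exp (- eta * y).
Proof.
  intros fc Hf y Hy. rewrite Cmod_mult, Rmult_assoc.
  apply Rmult_le_compat; auto using Cmod_ge_0. now apply Jost_flux_bound.
Qed.

Lemma Jost_map_derive (f : R -> C) (y : R) :
  continuous_Rplus f -> 0 <= y ->
  is_derive_C (Jost_map f) y (b y * Jost_flux f y)%C.
Proof.
  intros Hf Hy. unfold Jost_map. eapply is_derive_C_eq.
  - apply is_derive_C_minus; [apply is_derive_C_const |].
    apply tail_derive; auto. now apply Jost_integrand_cont.
  - cbv beta. ring.
Qed.

(** By the choice of [L], the bound on the integrand [b (n_f - n_g)] is exactly
    the derivative of [- k / 2 (w - 1)]. *)
Lemma Jost_map_contraction (f g : R -> C) (k : R) :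
  controlled w f -> controlled w g ->
  (forall y, 0 <= y -> Cmod (f y - g y) <= k * w y) ->
  forall y, 0 <= y -> Cmod (Jost_map f y - Jost_map g y) <= k / 2 * (w y - 1).
Proof.
  intros cf cg Hfg y Hy. pose proof cf as [fc [kf Hf]]. pose proof cg as [gc [kg Hg]].
  pose proof source_bound_nonneg as A0. pose proof coupling_nonneg as L0.
  assert (k0 : 0 <= k).
  { pose proof (Hfg y Hy). pose proof (weight_bounds y Hy).
    pose proof (Cmod_ge_0 (f y - g y)). nra. }
  set (Bd := fun k => B * (2 * alpha * k * (A / eta) * exp L) / eta).
  apply (compare_at_infinity
      (fun y => Jost_map f y - Jost_map g y)%C
      (fun y => b y * Jost_flux f y - b y * Jost_flux g y)%C
      (fun y => k / 2 * (w y - 1))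
      (fun y => - (k / 2 * L * eta) * (w y * exp (- eta * y)))
      (Bd kf + Bd kg) eta); auto.
  - intros t Ht. apply is_derive_C_minus; now apply Jost_map_derive.
  - intros t Ht. unfold w. auto_derive; auto. field.
  - intros t Ht. replace (b t * Jost_flux f t - b t * Jost_flux g t)%C
      with (b t * (Jost_flux f t - Jost_flux g t))%C by ring.
    rewrite Cmod_mult.
    replace (- (- (k / 2 * L * eta) * (w t * exp (- eta * t))))
      with (B * (2 * alpha * k * (A / eta) * (w t * exp (- eta * t))))
      by (unfold L; field; lra).
    apply Rmult_le_compat; auto using Cmod_ge_0. now apply Jost_flux_contraction.
  - intros t Ht. pose proof (weight_bounds t Ht). nra.
  - intros t Ht. unfold Jost_map.
    replace (RtoC 1 - tail (fun z => b z * Jost_flux f z) t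
             - (RtoC 1 - tail (fun z => b z * Jost_flux g z) t))%C
      with (- tail (fun z => b z * Jost_flux f z) t
             + tail (fun z => b z * Jost_flux g z) t)%C by ring.
    rewrite Rmult_plus_distr_r.
    eapply Rle_trans; [apply Cmod_triangle |]. rewrite Cmod_opp.
    apply Rplus_le_compat; apply tail_bound;
      auto using Jost_integrand_cont, Jost_integrand_bound.
Qed.

Lemma Jost_map_zero (y : R) : 0 <= y -> Jost_map (fun _ => RtoC 0) y = RtoC 1.
Proof.
  intros Hy. unfold Jost_map.
  enough (E : tail (fun z => b z * Jost_flux (fun _ => RtoC 0) z)%C y = RtoC 0)
    by (rewrite E; ring).
  apply Cmod_eq_0, Rle_antisym; [| apply Cmod_ge_0].
  apply Rle_trans with (0 / eta * exp (- eta * y)); [| right; field; lra].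
  apply tail_bound; auto.
  - apply Jost_integrand_cont, (zero_controlled w).
  - intros t Ht. rewrite Jost_flux_zero by auto.
    replace (b t * RtoC 0)%C with (RtoC 0) by ring. rewrite Cmod_0; lra.
Qed.

Lemma Jost_solution :
  exists m n : R -> C,
    (forall y, 0 <= y -> is_derive_C m y (b y * n y)%C) /\
    (forall y, 0 <= y -> is_derive_C n y (RtoC (2 * alpha) * (n y + a y * m y))%C) /\
    (forall y, 0 <= y -> Cmod (m y - RtoC 1) <= L * exp L * exp (- eta * y)) /\
    (forall y, 0 <= y -> Cmod (n y) <= 4 * alpha * (A / eta) * exp L * exp (- eta * y)).
Proof.
  destruct (weighted_fixed_point Jost_map w 1) as [f [[fc _] [Hf Ef]]].
  - intros r. exists (exp L). intros y Hy. pose proof (weight_bounds y ltac:(lra)); lra.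
  - intros f [fc [kf Hf]]. split.
    + apply continuous_Rplus_of_continuous. intros y Hy.
      eapply is_derive_C_continuous, Jost_map_derive; auto.
    + exists (Rabs kf / 2 + 1). intros y Hy.
      pose proof (Jost_map_contraction f (fun _ => RtoC 0) (Rabs kf)
        (conj fc (ex_intro _ kf Hf)) (zero_controlled w)) as H.
      assert (H1 : forall y, 0 <= y -> Cmod (f y - RtoC 0) <= Rabs kf * w y).
      { intros z Hz. replace (f z - RtoC 0)%C with (f z) by ring.
        pose proof (weight_bounds z Hz). pose proof (Rle_abs kf).
        eapply Rle_trans; [now apply Hf |]. apply Rmult_le_compat_r; lra. }
      specialize (H H1 y Hy). rewrite Jost_map_zero in H by auto.
      pose proof (Cmod_triangle (Jost_map f y - RtoC 1) (RtoC 1)) as T.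
      rewrite Cmod_1 in T.
      replace (Jost_map f y - RtoC 1 + RtoC 1)%C with (Jost_map f y) in T by ring.
      pose proof (weight_bounds y Hy). pose proof (Rabs_pos kf). nra.
  - intros f g k cf cg H y Hy.
    eapply Rle_trans; [now apply (Jost_map_contraction f g k) |].
    pose proof (H y Hy). pose proof (Cmod_ge_0 (f y - g y)).
    pose proof (weight_bounds y Hy). assert (0 <= k) by nra. nra.
  - intros y Hy. rewrite Jost_map_zero, Cmod_1 by auto. pose proof (weight_bounds y Hy); lra.
  - exists (Jost_map f), (Jost_flux f). split; [| split; [| split]].
    + intros y Hy. now apply Jost_map_derive.
    + intros y Hy. rewrite <- Ef by auto. now apply Jost_flux_derive.
    + intros y Hy. rewrite <- (Jost_map_zero y Hy).
      eapply Rle_trans; [apply (Jost_map_contraction f (fun _ => RtoC 0) 2); auto |].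
      * split; auto. now exists (2 * 1).
      * apply zero_controlled.
      * intros z Hz. replace (f z - RtoC 0)%C with (f z) by ring.
        specialize (Hf z Hz). lra.
      (* [exp x - 1 <= x exp x] for the exponent [x] of the weight *)
      * unfold w at 1. set (x := L * exp (- eta * y)).
        pose proof (weight_bounds y Hy) as W. unfold w in W. fold x in W.
        pose proof (exp_ineq1_le (- x)) as I.
        assert (E : exp x * exp (- x) = 1).
        { rewrite <- exp_plus. replace (x + - x) with 0 by ring. apply exp_0. }
        assert (0 <= x).
        { unfold x. apply Rmult_le_pos; [apply coupling_nonneg | apply Rlt_le, exp_pos]. }
        replace (L * exp L * exp (- eta * y)) with (x * exp L) by (unfold x; ring).
        assert (exp x * (1 - x) <= 1) by nra. nra.
    + intros y Hy. replace (4 * alpha) with (2 * alpha * (2 * 1)) by ring.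
      now apply Jost_flux_bound.
Qed.

End Jost.

(** * The initial value problem at the wall *)

Section Initial_value_problem.
Variables (Q : R -> C) (B : R) (p q : C).
Hypothesis Q_cont : continuous_Rplus Q.
Hypothesis Q_bounded : forall y, 0 <= y -> Cmod (Q y) <= B.

(** Two integrations of [Q f] gain [B / rate^2] in the norm [sup |f| / v], and
    [2 B <= rate^2]. *)
Let rate : R := 1 + 2 * B.
Let v (y : R) : R := exp (rate * y).

Definition Picard_slope (f : R -> C) (y : R) : C :=
  (q + prim (fun z => Q z * f z) y)%C.
Definition Picard_map (f : R -> C) (y : R) : C := (p + prim (Picard_slope f) y)%C.

Lemma rate_large : 1 <= rate /\ 0 <= B.
Proof.
  pose proof (Q_bounded 0 (Rle_refl 0)). pose proof (Cmod_ge_0 (Q 0)).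
  unfold rate; lra.
Qed.

Lemma Picard_slope_derive (f : R -> C) (y : R) :
  continuous_Rplus f -> 0 <= y -> is_derive_C (Picard_slope f) y (Q y * f y)%C.
Proof.
  intros Hf Hy. unfold Picard_slope. eapply is_derive_C_eq.
  - apply is_derive_C_plus; [apply is_derive_C_const |].
    apply prim_derive; auto. now apply continuous_Rplus_mult.
  - cbv beta; ring.
Qed.

Lemma Picard_map_derive (f : R -> C) (y : R) :
  continuous_Rplus f -> 0 <= y -> is_derive_C (Picard_map f) y (Picard_slope f y).
Proof.
  intros Hf Hy. unfold Picard_map. eapply is_derive_C_eq.
  - apply is_derive_C_plus; [apply is_derive_C_const |].
    apply prim_derive; auto. apply continuous_Rplus_of_continuous.
    intros z Hz. eapply is_derive_C_continuous, Picard_slope_derive; auto.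
  - cbv beta; ring.
Qed.

Lemma Picard_contraction (f g : R -> C) (k : R) :
  continuous_Rplus f -> continuous_Rplus g ->
  (forall y, 0 <= y -> Cmod (f y - g y) <= k * v y) ->
  forall y, 0 <= y -> Cmod (Picard_map f y - Picard_map g y) <= k / 2 * v y.
Proof.
  intros fc gc Hfg y Hy. destruct rate_large as [L1 B0].
  assert (k0 : 0 <= k).
  { pose proof (Hfg y Hy). pose proof (exp_pos (rate * y)).
    pose proof (Cmod_ge_0 (f y - g y)). unfold v in *. nra. }
  assert (Il : 0 < / rate) by (apply Rinv_0_lt_compat; lra).
  assert (D : forall s z, is_derive (fun t => s / rate * v t) z (s * v z)).
  { intros s z. unfold v. auto_derive; auto. field; lra. }
  assert (M1 : forall z, 0 <= z ->
     Cmod (Picard_slope f z - Picard_slope g z) <= k * B / rate * v z).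
  { apply (compare_from_0 (fun z => Picard_slope f z - Picard_slope g z)%C
      (fun z => Q z * f z - Q z * g z)%C _ (fun z => k * B * v z)).
    - intros t Ht. apply is_derive_C_minus; now apply Picard_slope_derive.
    - intros t Ht. apply D.
    - intros t Ht. replace (Q t * f t - Q t * g t)%C with ((f t - g t) * Q t)%C by ring.
      rewrite Cmod_mult. replace (k * B * v t) with (k * v t * B) by ring.
      apply Rmult_le_compat; auto using Cmod_ge_0.
    - unfold Picard_slope. rewrite !prim_0.
      replace (q + RtoC 0 - (q + RtoC 0))%C with (RtoC 0) by ring. rewrite Cmod_0.
      unfold v. pose proof (exp_pos (rate * 0)). unfold Rdiv.
      repeat apply Rmult_le_pos; lra. }
  apply Rle_trans with (k * B / rate / rate * v y).
  - apply (compare_from_0 (fun z => Picard_map f z - Picard_map g z)%C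
      (fun z => Picard_slope f z - Picard_slope g z)%C
      (fun z => k * B / rate / rate * v z) (fun z => k * B / rate * v z)); auto.
    + intros t Ht. apply is_derive_C_minus; now apply Picard_map_derive.
    + unfold Picard_map. rewrite !prim_0.
      replace (p + RtoC 0 - (p + RtoC 0))%C with (RtoC 0) by ring. rewrite Cmod_0.
      unfold v. pose proof (exp_pos (rate * 0)). unfold Rdiv.
      repeat apply Rmult_le_pos; lra.
  - apply Rmult_le_compat_r; [apply Rlt_le, exp_pos |].
    apply (Rmult_le_reg_r (rate * rate)); [nra |].
    replace (k * B / rate / rate * (rate * rate)) with (k * B) by (field; lra).
    assert (2 * B <= rate * rate) by (unfold rate in *; nra). nra.
Qed.

Lemma Picard_map_zero_bound (y : R) :
  0 <= y -> Cmod (Picard_map (fun _ => RtoC 0) y) <= (Cmod p + Cmod q) * v y.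
Proof.
  intros Hy. destruct rate_large as [L1 B0].
  pose proof (Cmod_ge_0 p). pose proof (Cmod_ge_0 q).
  assert (Zc : continuous_Rplus (fun _ => RtoC 0)) by apply (zero_controlled v).
  apply Rle_trans with (Cmod p + Cmod q * y).
  - apply (compare_from_0 (Picard_map (fun _ => RtoC 0)) (Picard_slope (fun _ => RtoC 0))
      (fun y => Cmod p + Cmod q * y) (fun _ => Cmod q)); auto.
    + intros t Ht. now apply Picard_map_derive.
    + intros t Ht. auto_derive; auto; ring.
    + apply (compare_from_0 (Picard_slope (fun _ => RtoC 0)) (fun z => Q z * RtoC 0)%C
        (fun _ => Cmod q) (fun _ => 0)).
      * intros t Ht. now apply (Picard_slope_derive (fun _ => RtoC 0)).
      * intros t Ht. auto_derive; auto.
      * intros t Ht. replace (Q t * RtoC 0)%C with (RtoC 0) by ring. rewrite Cmod_0; lra.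
      * unfold Picard_slope. rewrite prim_0. right. f_equal. ring.
    + unfold Picard_map. rewrite prim_0. replace (p + RtoC 0)%C with p by ring. lra.
  - assert (1 + y <= v y).
    { unfold v. pose proof (exp_ineq1_le (rate * y)). nra. }
    nra.
Qed.

Lemma initial_value_problem :
  exists phi dphi : R -> C,
    phi 0 = p /\ dphi 0 = q /\
    (forall y, 0 <= y -> is_derive_C phi y (dphi y)) /\
    (forall y, 0 <= y -> is_derive_C dphi y (Q y * phi y)%C).
Proof.
  destruct (weighted_fixed_point Picard_map v (Cmod p + Cmod q)) as [f [[fc _] [_ Ef]]].
  - intros r. exists (v r). intros y Hy. destruct rate_large.
    split; [apply Rlt_le, exp_pos |]. apply exp_le. nra.
  - intros f [fc [kf Hf]]. split.
    + apply continuous_Rplus_of_continuous. intros y Hy.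
      eapply is_derive_C_continuous, Picard_map_derive; auto.
    + exists (kf / 2 + (Cmod p + Cmod q)). intros y Hy.
      pose proof (Picard_contraction f (fun _ => RtoC 0) kf fc (proj1 (zero_controlled v))) as H.
      assert (H1 : forall y, 0 <= y -> Cmod (f y - RtoC 0) <= kf * v y).
      { intros z Hz. replace (f z - RtoC 0)%C with (f z) by ring. auto. }
      specialize (H H1 y Hy).
      pose proof (Picard_map_zero_bound y Hy) as H2.
      pose proof (Cmod_triangle_minus (Picard_map f y) (Picard_map (fun _ => RtoC 0) y)
        (RtoC 0)) as T.
      replace (Picard_map f y - RtoC 0)%C with (Picard_map f y) in T by ring.
      replace (Picard_map (fun _ => RtoC 0) y - RtoC 0)%C
        with (Picard_map (fun _ => RtoC 0) y) in T by ring.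
      lra.
  - intros f g k [fc _] [gc _]. now apply Picard_contraction.
  - apply Picard_map_zero_bound.
  - exists (Picard_map f), (Picard_slope f). split; [| split; [| split]].
    + unfold Picard_map. rewrite prim_0. ring.
    + unfold Picard_slope. rewrite prim_0. ring.
    + intros y Hy. now apply Picard_map_derive.
    + intros y Hy. rewrite <- Ef by auto. now apply Picard_slope_derive.
Qed.

End Initial_value_problem.

(** * One-sided derivatives *)

(** A limit point of the restricted filter at [y] can only be [y] itself, because
    [y] lies in the half-line. *)
Lemma is_derive_Rplus_of_is_derive (f : R -> C) (y : R) (l : C) :
  0 <= y -> is_derive_C f y l -> is_derive_Rplus (V := C_R_NormedModule) f y l.
Proof.
  intros Hy [Hl H]. split; [exact Hl |]. intros x Hx e.
  assert (Px : forall P : R -> Prop, locally x P -> P y).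
  { intros P HP. specialize (Hx P HP). unfold within in Hx.
    now apply (locally_singleton y _ Hx). }
  assert (E : y = x).
  { apply Rminus_diag_uniq, Rabs_eq_0, Rle_antisym; [| apply Rabs_pos].
    apply Rle_plus_epsilon. intros r Hr. rewrite Rplus_0_l. left.
    apply (Px (fun z => Rabs (z - x) < r)).
    exists (mkposreal r Hr). intros z Hz; exact Hz. }
  subst x. assert (Hyy : is_filter_lim (locally y) y) by (intros P HP; exact HP).
  generalize (H y Hyy e). unfold within. apply filter_imp. auto.
Qed.

(** Continuing [f] along its tangent at [0] replaces one-sided derivatives by
    two-sided ones. *)
Definition affine_extension (f f' : R -> R) (y : R) : R :=
  if Rle_dec 0 y then f y else f 0 + f' 0 * y.

Lemma affine_extension_pos (f f' : R -> R) (y : R) :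
  0 <= y -> affine_extension f f' y = f y.
Proof. intros Hy. unfold affine_extension. now destruct (Rle_dec 0 y). Qed.

Lemma affine_extension_derive (f f' : R -> R) (y : R) :
  0 <= y -> is_derive_Rplus (V := R_NormedModule) f y (f' y) ->
  is_derive (affine_extension f f') y (f' y).
Proof.
  intros Hy [Hl H]. split; [exact Hl |]. intros x Hx e.
  assert (Exy := is_filter_lim_locally_unique (V := R_NormedModule) y x Hx). subst x.
  assert (Hyy : is_filter_lim (within (fun x => 0 <= x) (locally y)) y).
  { intros P HP. unfold within. generalize HP. apply filter_imp. auto. }
  specialize (H y Hyy e). unfold within in H.
  assert (L : locally y (fun z => 0 < y -> 0 < z)).
  { destruct (Rle_lt_or_eq_dec 0 y Hy) as [P | P].
    - exists (mkposreal y P). intros z Hz _.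
      change (Rabs (z - y) < y) in Hz. apply Rabs_def2 in Hz. lra.
    - apply filter_forall. intros z Hz. lra. }
  generalize (filter_and _ _ H L). apply filter_imp. intros z [Hz Lz].
  rewrite (affine_extension_pos f f' y Hy). unfold affine_extension.
  destruct (Rle_dec 0 z) as [Z | Z]; [now apply Hz |].
  assert (y = 0) by (destruct (Rle_lt_or_eq_dec 0 y Hy); [specialize (Lz r); lra | auto]).
  subst y.
  match goal with |- norm ?t <= _ => replace t with 0 end.
  - change (Rabs 0 <= e * Rabs (z - 0)). rewrite Rabs_R0.
    apply Rmult_le_pos; [apply Rlt_le, e | apply Rabs_pos].
  - unfold minus, plus, opp, scal; simpl. unfold mult; simpl. ring.
Qed.

Lemma profile_extension (Us : R -> R) (dU : nat -> R -> R) :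
  smooth_Rplus Us dU ->
  exists V0 V1 V2 : R -> R, forall y, 0 <= y ->
    V0 y = Us y /\ V1 y = dU 1%nat y /\ V2 y = dU 2%nat y /\
    is_derive V0 y (V1 y) /\ is_derive V1 y (V2 y) /\ continuous V2 y.
Proof.
  intros [H0 H].
  exists (affine_extension (dU 0%nat) (dU 1%nat)), (affine_extension (dU 1%nat) (dU 2%nat)),
    (affine_extension (dU 2%nat) (dU 3%nat)).
  intros y Hy. rewrite !affine_extension_pos by auto.
  split; [auto | split; [auto | split; [auto |]]].
  split; [| split].
  - now apply affine_extension_derive, H.
  - now apply affine_extension_derive, H.
  - apply (ex_derive_continuous (V := R_NormedModule)). exists (dU 3%nat y).
    now apply affine_extension_derive, H.
Qed.

(** * Second-order equations on the half-line *)

Definition solves (Q : R -> C) (f df : R -> C) : Prop :=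
  forall y, 0 <= y -> is_derive_C f y (df y) /\ is_derive_C df y (Q y * f y)%C.

Lemma Wronskian_constant (Q f df g dg : R -> C) :
  solves Q f df -> solves Q g dg ->
  forall y, 0 <= y -> Wronskian f df g dg y = Wronskian f df g dg 0.
Proof.
  intros Hf Hg y Hy.
  enough (E : Cmod (Wronskian f df g dg y - Wronskian f df g dg 0) <= 0 - 0).
  { rewrite Rminus_diag in E.
    apply Rle_antisym in E; [| apply Cmod_ge_0]. symmetry in E. apply Cmod_eq_0 in E.
    replace (Wronskian f df g dg y)
      with (Wronskian f df g dg y - Wronskian f df g dg 0 + Wronskian f df g dg 0)%C by ring.
    rewrite E. ring. }
  apply (mean_value_C _ (fun _ => RtoC 0) (fun _ => 0) (fun _ => 0)); auto.
  - intros t [Ht _]. destruct (Hf t Ht) as [f1 f2]. destruct (Hg t Ht) as [g1 g2].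
    unfold Wronskian. eapply is_derive_C_eq.
    + apply is_derive_C_minus; apply is_derive_C_mult; eassumption.
    + cbv beta; ring.
  - intros t _. auto_derive; auto.
  - intros t _. rewrite Cmod_0; lra.
Qed.

Lemma Wronskian_one_independent (f df g dg : R -> C) :
  (forall y, 0 <= y -> is_derive_C f y (df y)) ->
  (forall y, 0 <= y -> is_derive_C g y (dg y)) ->
  (forall y, 0 <= y -> Wronskian g dg f df y = RtoC 1) ->
  independent_Rplus f g.
Proof.
  intros Hf Hg W a b H.
  (* an interior point, where the derivative of the zero combination is two-sided *)
  assert (E1 : (a * df 1 + b * dg 1 = RtoC 0)%C).
  { assert (D1 : is_derive_C (fun y => a * f y + b * g y)%C 1 (a * df 1 + b * dg 1)%C).
    { eapply is_derive_C_eq.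
      - apply is_derive_C_plus; apply is_derive_C_mult;
          [apply is_derive_C_const | apply Hf; lra | apply is_derive_C_const | apply Hg; lra].
      - cbv beta; ring. }
    assert (D0 : is_derive_C (fun y => a * f y + b * g y)%C 1 (RtoC 0)).
    { apply (is_derive_ext_loc (V := C_R_NormedModule) (fun _ => RtoC 0));
        [| apply is_derive_C_const].
      exists (mkposreal 1 Rlt_0_1). intros z Hz. change (Rabs (z - 1) < 1) in Hz.
      apply Rabs_def2 in Hz. symmetry; apply H; lra. }
    pose proof (is_derive_C_Re _ _ _ D1) as R1. pose proof (is_derive_C_Re _ _ _ D0) as R0.
    pose proof (is_derive_C_Im _ _ _ D1) as I1. pose proof (is_derive_C_Im _ _ _ D0) as I0.
    apply is_derive_unique in R1, R0, I1, I0.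
    rewrite (surjective_pairing (a * df 1 + b * dg 1)%C), <- R1, <- I1, R0, I0.
    reflexivity. }
  pose proof (H 1 Rle_0_1) as E0. pose proof (W 1 Rle_0_1) as W1. unfold Wronskian in W1.
  split.
  - transitivity (a * (g 1 * df 1 - dg 1 * f 1))%C; [rewrite W1; ring |].
    transitivity (g 1 * (a * df 1 + b * dg 1) - dg 1 * (a * f 1 + b * g 1))%C; [ring |].
    rewrite E0, E1. ring.
  - transitivity (b * (g 1 * df 1 - dg 1 * f 1))%C; [rewrite W1; ring |].
    transitivity (df 1 * (a * f 1 + b * g 1) - f 1 * (a * df 1 + b * dg 1))%C; [ring |].
    rewrite E0, E1. ring.
Qed.

Lemma solves_scal (Q f df : R -> C) (s : C) :
  solves Q f df -> solves Q (fun y => s * f y)%C (fun y => s * df y)%C.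
Proof.
  intros Hf y Hy. destruct (Hf y Hy) as [f1 f2]. split.
  - eapply is_derive_C_eq; [apply is_derive_C_mult; [apply is_derive_C_const | eassumption] |].
    cbv beta; ring.
  - eapply is_derive_C_eq; [apply is_derive_C_mult; [apply is_derive_C_const | eassumption] |].
    cbv beta; ring.
Qed.

(** If both Cauchy data of [f] at [0] vanished, its Wronskians with a
    fundamental system would vanish, hence so would [f]. *)
Lemma unit_Wronskian_partner (Q f df : R -> C) (B Y : R) :
  continuous_Rplus Q -> (forall y, 0 <= y -> Cmod (Q y) <= B) ->
  solves Q f df -> 0 <= Y -> f Y <> RtoC 0 ->
  exists g dg, solves Q g dg /\ forall y, 0 <= y -> Wronskian f df g dg y = RtoC 1.
Proof.
  intros Qc Qb Hf HY NY.
  destruct (initial_value_problem Q B (RtoC 1) (RtoC 0) Qc Qb) as (g1 & dg1 & A1 & B1 & C1 & D1).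
  destruct (initial_value_problem Q B (RtoC 0) (RtoC 1) Qc Qb) as (g2 & dg2 & A2 & B2 & C2 & D2).
  assert (S1 : solves Q g1 dg1) by (intros y Hy; split; auto).
  assert (S2 : solves Q g2 dg2) by (intros y Hy; split; auto).
  assert (K : forall g dg, solves Q g dg -> Wronskian f df g dg 0 <> RtoC 0 ->
    exists g dg, solves Q g dg /\ forall y, 0 <= y -> Wronskian f df g dg y = RtoC 1).
  { intros g dg Sg N. set (s := (/ Wronskian f df g dg 0)%C).
    exists (fun y => s * g y)%C, (fun y => s * dg y)%C. split; [now apply solves_scal |].
    intros y Hy. transitivity (s * Wronskian f df g dg y)%C; [unfold Wronskian; ring |].
    rewrite (Wronskian_constant Q) by auto. unfold s. now field. }
  destruct (Ceq_dec (Wronskian f df g1 dg1 0) (RtoC 0)) as [Z1 | N1]; [| now apply (K g1 dg1)].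
  destruct (Ceq_dec (Wronskian f df g2 dg2 0) (RtoC 0)) as [Z2 | N2]; [| now apply (K g2 dg2)].
  exfalso. apply NY.
  pose proof (Wronskian_constant Q f df g1 dg1 Hf S1 Y HY) as W1.
  pose proof (Wronskian_constant Q f df g2 dg2 Hf S2 Y HY) as W2.
  pose proof (Wronskian_constant Q g1 dg1 g2 dg2 S1 S2 Y HY) as W3.
  rewrite Z1 in W1. rewrite Z2 in W2.
  assert (W0 : Wronskian g1 dg1 g2 dg2 0 = RtoC 1).
  { unfold Wronskian. rewrite A1, B1, A2, B2. ring. }
  rewrite W0 in W3. unfold Wronskian in W1, W2, W3.
  transitivity (f Y * (g1 Y * dg2 Y - dg1 Y * g2 Y))%C; [rewrite W3; ring |].
  transitivity (g1 Y * (f Y * dg2 Y - df Y * g2 Y) - g2 Y * (f Y * dg1 Y - df Y * g1 Y))%C;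
    [ring |].
  rewrite W1, W2. ring.
Qed.

(** Where [f] does not vanish, [(g / f)' = 1 / f^2 = O(exp (2 alpha y))]. *)
Lemma partner_growth (f df g dg : R -> C) (alpha k k' Y : R) :
  0 < alpha -> 0 < k -> 0 <= Y ->
  (forall y, 0 <= y -> is_derive_C f y (df y)) ->
  (forall y, 0 <= y -> is_derive_C g y (dg y)) ->
  (forall y, 0 <= y -> Wronskian f df g dg y = RtoC 1) ->
  (forall y, Y <= y -> k * exp (- alpha * y) <= Cmod (f y) <= k' * exp (- alpha * y)) ->
  exists M, forall y, Y <= y -> Cmod (g y) <= M * exp (alpha * y).
Proof.
  intros Ha Hk HY Hf Hg W Hb.
  assert (Nf : forall y, Y <= y -> f y <> RtoC 0).
  { intros y Hy. apply Cmod_gt_0. destruct (Hb y Hy) as [H _].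
    pose proof (exp_pos (- alpha * y)). nra. }
  set (s := / (k * k) / (2 * alpha)).
  assert (s0 : 0 < s).
  { unfold s, Rdiv. apply Rmult_lt_0_compat; apply Rinv_0_lt_compat; nra. }
  exists (k' * (Cmod (g Y / f Y) + s)). intros y Hy.
  assert (M : Cmod (g y / f y - g Y / f Y)
            <= s * exp (2 * alpha * y) - s * exp (2 * alpha * Y)).
  { apply (mean_value_C (fun t => g t / f t)%C (fun t => / (f t * f t))%C
      (fun t => s * exp (2 * alpha * t)) (fun t => s * (2 * alpha) * exp (2 * alpha * t)));
      auto.
    - intros t [Ht _]. pose proof (Nf t Ht). specialize (W t ltac:(lra)).
      unfold Wronskian in W. unfold Cdiv. eapply is_derive_C_eq.
      + apply is_derive_C_mult; [apply Hg; lra |].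
        apply is_derive_C_inv; [apply Hf; lra | auto].
      + cbv beta. transitivity ((f t * dg t - df t * g t) / (f t * f t))%C; [now field |].
        rewrite W. now field.
    - intros t _. apply is_derive_exp_scaled.
    - intros t [Ht _]. pose proof (Nf t Ht). rewrite Cmod_inv by now apply Cmult_neq_0.
      rewrite Cmod_mult. destruct (Hb t Ht) as [H1 _].
      set (x := exp (- alpha * t)) in *.
      assert (Ex : exp (2 * alpha * t) = / (x * x)).
      { unfold x. rewrite <- exp_plus, <- exp_Ropp. f_equal. ring. }
      rewrite Ex. assert (x0 : 0 < x) by apply exp_pos.
      replace (s * (2 * alpha) * / (x * x)) with (/ ((k * x) * (k * x)))
        by (unfold s; field; repeat split; lra).
      assert (0 < k * x) by nra.
      apply Rinv_le_contravar; [nra |]. apply Rmult_le_compat; lra. }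
  assert (Q : Cmod (g y / f y) <= (Cmod (g Y / f Y) + s) * exp (2 * alpha * y)).
  { pose proof (Cmod_triangle_minus (g y / f y) (g Y / f Y) (RtoC 0)) as T.
    replace (g y / f y - RtoC 0)%C with (g y / f y)%C in T by ring.
    replace (g Y / f Y - RtoC 0)%C with (g Y / f Y)%C in T by ring.
    assert (1 <= exp (2 * alpha * y)) by (rewrite <- exp_0; apply exp_le; nra).
    pose proof (exp_pos (2 * alpha * Y)). pose proof (Cmod_ge_0 (g Y / f Y)). nra. }
  replace (g y) with (f y * (g y / f y))%C by (field; now apply Nf).
  rewrite Cmod_mult. destruct (Hb y Hy) as [_ H2].
  replace (k' * (Cmod (g Y / f Y) + s) * exp (alpha * y))
    with ((k' * exp (- alpha * y)) * ((Cmod (g Y / f Y) + s) * exp (2 * alpha * y))).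
  - apply Rmult_le_compat; auto using Cmod_ge_0.
  - replace (2 * alpha * y) with (alpha * y + alpha * y) by ring.
    rewrite exp_plus. replace (- alpha * y) with (- (alpha * y)) by ring.
    rewrite exp_Ropp. field. pose proof (exp_pos (alpha * y)); lra.
Qed.

(** * Expansion of the logarithmic derivative *)

Section Expansion.
Variables (alpha eta K d D N : R) (F dF m n : R -> C) (Fp : C).
Hypothesis alpha_pos : 0 < alpha.
Hypothesis eta_pos : 0 < eta.
Hypothesis d_pos : 0 < d.
Hypothesis F_derive : forall y, 0 <= y -> is_derive_C F y (dF y).
Hypothesis F_bounds : forall y, 0 <= y -> d <= Cmod (F y) <= D.
Hypothesis Fp_bounds : d <= Cmod Fp <= D.
Hypothesis F_limit : forall y, 0 <= y -> Cmod (F y - Fp) <= K * exp (- eta * y).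
Hypothesis m_derive : forall y, 0 <= y -> is_derive_C m y (/ (F y * F y) * n y)%C.
Hypothesis n_derive : forall y, 0 <= y ->
  is_derive_C n y (RtoC (2 * alpha) * (n y + F y * dF y * m y))%C.
Hypothesis m_large : forall y, 0 <= y -> / 2 <= Cmod (m y).
Hypothesis n_decay : forall y, 0 <= y -> Cmod (n y) <= N * alpha * exp (- eta * y).

Definition Omega_profile (z : R) : C := (F z ^ 2 / Fp ^ 2 - Fp ^ 2 / F z ^ 2)%C.

(** With [phi = exp (- alpha y) m], this is [F^2 phi' / (alpha phi) + Fp^2]. *)
Definition Riccati_defect (y : R) : C := (Fp ^ 2 - F y ^ 2 + n y / (RtoC alpha * m y))%C.

Definition defect_bound : R := 2 * D * K + 2 * N.
(** The decay constant of [Fp^2 Omega_profile = F^2 - Fp^4 / F^2]. *)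
Definition profile_bound : R := K * (2 * D) * (2 * D ^ 2) / d ^ 2.
Definition quadratic_bound : R := (2 * D ^ 2 + defect_bound) / d ^ 2.
Definition first_order_bound : R := (profile_bound + defect_bound * quadratic_bound) / eta.
Definition expansion_bound : R := first_order_bound * quadratic_bound / eta.

Lemma F_nonzero (y : R) : 0 <= y -> F y <> RtoC 0.
Proof. intros Hy. apply Cmod_gt_0. destruct (F_bounds y Hy). lra. Qed.

Lemma Fp_nonzero : Fp <> RtoC 0.
Proof. apply Cmod_gt_0. destruct Fp_bounds. lra. Qed.

Lemma m_nonzero (y : R) : 0 <= y -> m y <> RtoC 0.
Proof. intros Hy. apply Cmod_gt_0. pose proof (m_large y Hy). lra. Qed.

Lemma alpha_nonzero : RtoC alpha <> RtoC 0.
Proof. intros E. apply RtoC_inj in E. lra. Qed.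

Lemma D_pos : 0 < D.
Proof. destruct Fp_bounds. lra. Qed.

Lemma K_nonneg : 0 <= K.
Proof.
  pose proof (F_limit 0 (Rle_refl 0)) as H. rewrite Rmult_0_r, exp_0, Rmult_1_r in H.
  pose proof (Cmod_ge_0 (F 0 - Fp)); lra.
Qed.

Lemma N_nonneg : 0 <= N.
Proof.
  pose proof (n_decay 0 (Rle_refl 0)) as H. rewrite Rmult_0_r, exp_0, Rmult_1_r in H.
  pose proof (Cmod_ge_0 (n 0)). nra.
Qed.

Lemma d2_pos : 0 < d ^ 2.
Proof. apply pow_lt; auto. Qed.

Lemma squares_decay (y : R) :
  0 <= y -> Cmod (F y ^ 2 - Fp ^ 2) <= 2 * D * K * exp (- eta * y).
Proof.
  intros Hy. replace (F y ^ 2 - Fp ^ 2)%C with ((F y + Fp) * (F y - Fp))%C by ring.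
  rewrite Cmod_mult, Rmult_assoc. apply Rmult_le_compat; auto using Cmod_ge_0.
  pose proof (Cmod_triangle (F y) Fp). destruct (F_bounds y Hy), Fp_bounds. lra.
Qed.

Lemma div_square_bound (z : C) (s y : R) :
  0 <= y -> Cmod z <= s -> Cmod (z / F y ^ 2) <= s / d ^ 2.
Proof.
  intros Hy Hz. pose proof d2_pos. pose proof (F_nonzero y Hy).
  rewrite Cmod_div, Cmod_pow by now apply Cpow_nz.
  apply Rmult_le_compat; auto using Cmod_ge_0.
  - apply Rlt_le, Rinv_0_lt_compat, pow_lt. destruct (F_bounds y Hy). lra.
  - apply Rinv_le_contravar; auto. apply pow_incr. destruct (F_bounds y Hy). lra.
Qed.

Lemma scaled_profile_decay (y : R) :
  0 <= y -> Cmod (Fp ^ 2 * Omega_profile y) <= profile_bound * exp (- eta * y).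
Proof.
  intros Hy. pose proof (F_nonzero y Hy). pose proof Fp_nonzero.
  replace (Fp ^ 2 * Omega_profile y)%C
    with ((F y ^ 2 - Fp ^ 2) * (F y ^ 2 + Fp ^ 2) / F y ^ 2)%C
    by (unfold Omega_profile; field; auto).
  unfold profile_bound.
  replace (K * (2 * D) * (2 * D ^ 2) / d ^ 2 * exp (- eta * y))
    with (2 * D * K * exp (- eta * y) * (2 * D ^ 2) / d ^ 2) by (field; lra).
  apply div_square_bound; auto. rewrite Cmod_mult.
  apply Rmult_le_compat; auto using Cmod_ge_0, squares_decay.
  eapply Rle_trans; [apply Cmod_triangle |]. rewrite !Cmod_pow.
  destruct (F_bounds y Hy), Fp_bounds.
  assert (Cmod (F y) ^ 2 <= D ^ 2) by (apply pow_incr; split; [apply Cmod_ge_0 | auto]).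
  assert (Cmod Fp ^ 2 <= D ^ 2) by (apply pow_incr; split; [apply Cmod_ge_0 | auto]).
  lra.
Qed.

Lemma Omega_profile_decay (y : R) :
  0 <= y -> Cmod (Omega_profile y) <= profile_bound / d ^ 2 * exp (- eta * y).
Proof.
  intros Hy. pose proof Fp_nonzero. pose proof d2_pos.
  replace (Omega_profile y) with (Fp ^ 2 * Omega_profile y / Fp ^ 2)%C
    by (field; auto).
  rewrite Cmod_div, Cmod_pow by now apply Cpow_nz.
  replace (profile_bound / d ^ 2 * exp (- eta * y))
    with (profile_bound * exp (- eta * y) / d ^ 2) by (field; lra).
  apply Rmult_le_compat; auto using Cmod_ge_0, scaled_profile_decay.
  - apply Rlt_le, Rinv_0_lt_compat, pow_lt. destruct Fp_bounds. lra.
  - apply Rinv_le_contravar; auto. apply pow_incr. destruct Fp_bounds. lra.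
Qed.

Lemma Omega_profile_cont : continuous_Rplus Omega_profile.
Proof.
  apply continuous_Rplus_of_continuous. intros y Hy.
  pose proof (F_nonzero y Hy). pose proof (F_derive y Hy) as D1.
  apply (continuous_ext (fun z => F z * F z * / Fp ^ 2 - Fp ^ 2 * / (F z * F z))%C).
  { intros z. unfold Omega_profile, Cdiv. simpl Cpow. rewrite !Cmult_1_r. reflexivity. }
  eapply is_derive_C_continuous. apply is_derive_C_minus.
  - apply is_derive_C_mult; [now apply is_derive_C_mult; exact D1 | apply is_derive_C_const].
  - apply is_derive_C_mult; [apply is_derive_C_const |].
    apply is_derive_C_inv; [now apply is_derive_C_mult; exact D1 | now apply Cmult_neq_0].
Qed.

Lemma defect_decay (y : R) :
  0 <= y -> Cmod (Riccati_defect y) <= defect_bound * exp (- eta * y).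
Proof.
  intros Hy. unfold Riccati_defect, defect_bound. rewrite Rmult_plus_distr_r.
  eapply Rle_trans; [apply Cmod_triangle |]. apply Rplus_le_compat.
  - rewrite Cmod_minus_sym. now apply squares_decay.
  - pose proof (m_nonzero y Hy). pose proof alpha_nonzero. pose proof (m_large y Hy).
    rewrite Cmod_div by now apply Cmult_neq_0.
    rewrite Cmod_mult, Cmod_R, Rabs_pos_eq by lra.
    pose proof (n_decay y Hy). apply Rle_div_l; [nra |].
    eapply Rle_trans; [eassumption |].
    pose proof N_nonneg. pose proof (exp_pos (- eta * y)).
    assert (0 <= N * exp (- eta * y)) by nra.
    assert (0 <= N * exp (- eta * y) * alpha) by nra. nra.
Qed.

(** The Riccati equation [H' = alpha (F^2 - H^2 / F^2)] of
    [H = Riccati_defect - Fp^2], sorted by powers of the defect. *)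
Lemma defect_derive (y : R) :
  0 <= y ->
  is_derive_C Riccati_defect y
    (RtoC alpha * (Fp ^ 2 * Omega_profile y
       + (2 * Fp ^ 2 * Riccati_defect y - Riccati_defect y ^ 2) / F y ^ 2))%C.
Proof.
  intros Hy. pose proof (F_nonzero y Hy). pose proof (m_nonzero y Hy).
  pose proof alpha_nonzero. pose proof Fp_nonzero.
  pose proof (F_derive y Hy) as D1. pose proof (m_derive y Hy) as D2.
  pose proof (n_derive y Hy) as D3.
  apply (is_derive_ext (V := C_R_NormedModule)
    (fun z => Fp ^ 2 - F z * F z + n z * / (RtoC alpha * m z))%C).
  { intros z. unfold Riccati_defect, Cdiv. simpl Cpow. rewrite !Cmult_1_r. reflexivity. }
  eapply is_derive_C_eq.
  - apply is_derive_C_plus.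
    + apply is_derive_C_minus; [apply is_derive_C_const |].
      apply is_derive_C_mult; exact D1.
    + apply is_derive_C_mult; [exact D3 |].
      apply is_derive_C_inv; [| now apply Cmult_neq_0].
      apply is_derive_C_mult; [apply is_derive_C_const | exact D2].
  - cbv beta. unfold Riccati_defect, Omega_profile. rewrite RtoC_mult. field.
    auto.
Qed.

Lemma quadratic_term_bound (y : R) :
  0 <= y ->
  Cmod ((2 * Fp ^ 2 * Riccati_defect y - Riccati_defect y ^ 2) / F y ^ 2)
    <= Cmod (Riccati_defect y) * quadratic_bound.
Proof.
  intros Hy. unfold quadratic_bound.
  replace (Cmod (Riccati_defect y) * ((2 * D ^ 2 + defect_bound) / d ^ 2))
    with (Cmod (Riccati_defect y) * (2 * D ^ 2 + defect_bound) / d ^ 2) by (field; lra).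
  apply div_square_bound; auto.
  replace (2 * Fp ^ 2 * Riccati_defect y - Riccati_defect y ^ 2)%C
    with (Riccati_defect y * (2 * Fp ^ 2 - Riccati_defect y))%C by ring.
  rewrite Cmod_mult. apply Rmult_le_compat_l; [apply Cmod_ge_0 |].
  unfold Cminus. eapply Rle_trans; [apply Cmod_triangle |].
  rewrite Cmod_opp, Cmod_mult, Cmod_pow, Cmod_R, Rabs_pos_eq by lra.
  assert (Cmod Fp ^ 2 <= D ^ 2).
  { destruct Fp_bounds. apply pow_incr; split; [apply Cmod_ge_0 | auto]. }
  pose proof (defect_decay y Hy).
  assert (exp (- eta * y) <= 1) by (rewrite <- exp_0; apply exp_le; nra).
  assert (0 <= defect_bound).
  { unfold defect_bound. pose proof D_pos. pose proof K_nonneg. pose proof N_nonneg. nra. }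
  nra.
Qed.

Lemma bounds_nonneg : 0 <= defect_bound /\ 0 <= quadratic_bound.
Proof.
  assert (0 <= defect_bound).
  { unfold defect_bound. pose proof D_pos. pose proof K_nonneg. pose proof N_nonneg. nra. }
  split; auto. unfold quadratic_bound. pose proof d2_pos. pose proof D_pos.
  apply Rmult_le_pos; [nra | now apply Rlt_le, Rinv_0_lt_compat].
Qed.

(** The crude bound on the defect makes its derivative [O(alpha exp (- eta y))],
    hence the defect itself, which vanishes at infinity, is of order [alpha]. *)
Lemma defect_first_order (y : R) :
  0 <= y -> Cmod (Riccati_defect y) <= alpha * first_order_bound * exp (- eta * y).
Proof.
  intros Hy. destruct bounds_nonneg as [H0 S0].
  unfold first_order_bound.
  replace (alpha * ((profile_bound + defect_bound * quadratic_bound) / eta))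
    with (alpha * (profile_bound + defect_bound * quadratic_bound) / eta) by (field; lra).
  apply (compare_exp Riccati_defect _ defect_bound
    (alpha * (profile_bound + defect_bound * quadratic_bound)) eta eta_pos
    (defect_derive)); auto using defect_decay.
  intros t Ht. rewrite Cmod_mult, Cmod_R, Rabs_pos_eq, Rmult_assoc by lra.
  apply Rmult_le_compat_l; [lra |]. eapply Rle_trans; [apply Cmod_triangle |].
  rewrite Rmult_plus_distr_r. apply Rplus_le_compat; [now apply scaled_profile_decay |].
  eapply Rle_trans; [now apply quadratic_term_bound |].
  pose proof (defect_decay t Ht). nra.
Qed.

(** Adding [alpha Fp^2 tail Omega_profile] removes the source term from the
    equation of the defect; what remains is quadratically small in [alpha]. *)
Lemma defect_second_order :
  Cmod (Riccati_defect 0 + RtoC alpha * Fp ^ 2 * tail Omega_profile 0)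
    <= expansion_bound * alpha ^ 2.
Proof.
  destruct bounds_nonneg as [H0 S0].
  assert (Hp := tail_bound Omega_profile _ eta eta_pos Omega_profile_cont Omega_profile_decay).
  destruct Hp as [_ Hp].
  assert (E : forall y, 0 <= y ->
    Cmod (Riccati_defect y + RtoC alpha * Fp ^ 2 * tail Omega_profile y)
      <= alpha * (alpha * first_order_bound * quadratic_bound) / eta * exp (- eta * y)).
  { apply (compare_exp (fun y => Riccati_defect y + RtoC alpha * Fp ^ 2 * tail Omega_profile y)%C
      (fun y => RtoC alpha *
         ((2 * Fp ^ 2 * Riccati_defect y - Riccati_defect y ^ 2) / F y ^ 2))%C
      (defect_bound + Cmod (RtoC alpha * Fp ^ 2) * (profile_bound / d ^ 2 / eta))); auto.
    - intros t Ht. eapply is_derive_C_eq.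
      + apply is_derive_C_plus; [now apply defect_derive |].
        apply is_derive_C_mult; [apply is_derive_C_const |].
        apply tail_derive; auto using Omega_profile_cont.
      + cbv beta. ring.
    - intros t Ht. rewrite Cmod_mult, Cmod_R, Rabs_pos_eq, Rmult_assoc by lra.
      apply Rmult_le_compat_l; [lra |].
      eapply Rle_trans; [now apply quadratic_term_bound |].
      pose proof (defect_first_order t Ht). nra.
    - intros t Ht. eapply Rle_trans; [apply Cmod_triangle |].
      rewrite Rmult_plus_distr_r. apply Rplus_le_compat; [now apply defect_decay |].
      rewrite Cmod_mult, Rmult_assoc. apply Rmult_le_compat_l; [apply Cmod_ge_0 |].
      now apply Hp. }
  eapply Rle_trans; [apply E; lra |].
  rewrite Rmult_0_r, exp_0. unfold expansion_bound. right. field. lra.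
Qed.

End Expansion.

(** * Solutions of the Rayleigh equation *)

Section Rayleigh.
Variables (Us : R -> R) (dU : nat -> R -> R) (Uplus K eta : R) (V0 V1 V2 : R -> R).
Hypothesis eta_pos : 0 < eta.
Hypothesis extension : forall y, 0 <= y ->
  V0 y = Us y /\ V1 y = dU 1%nat y /\ V2 y = dU 2%nat y /\
  is_derive V0 y (V1 y) /\ is_derive V1 y (V2 y) /\ continuous V2 y.
Hypothesis decay : forall y, 0 <= y ->
  Rabs (Us y - Uplus) <= K * exp (- eta * y) /\
  Rabs (dU 1%nat y) <= K * exp (- eta * y) /\
  Rabs (dU 2%nat y) <= K * exp (- eta * y).

Definition speed (c : C) (y : R) : C := (RtoC (V0 y) - c)%C.
Definition speed_max (c : C) : R := Rabs Uplus + K + Cmod c.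
(** The equation in the form [psi'' = potential psi]. *)
Definition potential (alpha : R) (c : C) (y : R) : C :=
  (RtoC alpha ^ 2 + RtoC (V2 y) * / speed c y)%C.

Lemma K_pos : 0 <= K.
Proof.
  destruct (decay 0 (Rle_refl 0)) as [H _]. rewrite Rmult_0_r, exp_0, Rmult_1_r in H.
  pose proof (Rabs_pos (Us 0 - Uplus)). lra.
Qed.

Lemma exp_decay_le_1 (y : R) : 0 <= y -> 0 < exp (- eta * y) <= 1.
Proof.
  intros Hy. split; [apply exp_pos |]. rewrite <- exp_0. apply exp_le. nra.
Qed.

Lemma speed_limit (c : C) (y : R) :
  0 <= y -> Cmod (speed c y - (RtoC Uplus - c)) <= K * exp (- eta * y).
Proof.
  intros Hy. unfold speed. destruct (extension y Hy) as [-> _].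
  replace (RtoC (Us y) - c - (RtoC Uplus - c))%C with (RtoC (Us y - Uplus))
    by (rewrite RtoC_minus; ring).
  rewrite Cmod_R. now apply decay.
Qed.

Lemma limit_speed_max (c : C) : Cmod (RtoC Uplus - c) <= speed_max c.
Proof.
  unfold speed_max, Cminus. eapply Rle_trans; [apply Cmod_triangle |].
  rewrite Cmod_opp, Cmod_R. pose proof K_pos. lra.
Qed.

Lemma speed_le_max (c : C) (y : R) : 0 <= y -> Cmod (speed c y) <= speed_max c.
Proof.
  intros Hy. pose proof (speed_limit c y Hy). pose proof (exp_decay_le_1 y Hy).
  pose proof K_pos.
  replace (speed c y) with (speed c y - (RtoC Uplus - c) + (RtoC Uplus - c))%C by ring.
  eapply Rle_trans; [apply Cmod_triangle |].
  unfold speed_max. unfold Cminus at 3. pose proof (Cmod_triangle (RtoC Uplus) (- c)) as T.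
  rewrite Cmod_opp, Cmod_R in T. nra.
Qed.

Lemma limit_speed_min (c : C) (d : R) :
  (forall y, 0 <= y -> d <= Cmod (speed c y)) -> d <= Cmod (RtoC Uplus - c).
Proof.
  intros Hd. apply Rle_plus_epsilon. intros e He.
  destruct (exp_decay_small K eta e 0 eta_pos He) as [z [_ [Hz Sz]]].
  pose proof (speed_limit c z Hz) as H1. pose proof (Hd z Hz) as H2.
  pose proof (Cmod_triangle (speed c z - (RtoC Uplus - c)) (RtoC Uplus - c)) as T.
  replace (speed c z - (RtoC Uplus - c) + (RtoC Uplus - c))%C with (speed c z) in T by ring.
  lra.
Qed.

Lemma speed_derive (c : C) (y : R) : 0 <= y -> is_derive_C (speed c) y (RtoC (V1 y)).
Proof.
  intros Hy. destruct (extension y Hy) as (_ & _ & _ & D & _).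
  unfold speed. eapply is_derive_C_eq.
  - apply is_derive_C_minus; [apply is_derive_C_RtoC; exact D | apply is_derive_C_const].
  - ring.
Qed.

Lemma Rayleigh_of_solves (alpha : R) (c : C) (f df : R -> C) :
  (forall y, 0 <= y -> speed c y <> RtoC 0) ->
  solves (potential alpha c) f df -> Rayleigh_solution Us dU alpha c f df.
Proof.
  intros Hc Hf y Hy. destruct (Hf y Hy) as [f1 f2]. split.
  - now apply is_derive_Rplus_of_is_derive.
  - exists (potential alpha c y * f y)%C. split; [now apply is_derive_Rplus_of_is_derive |].
    specialize (Hc y Hy). unfold potential, speed in *.
    destruct (extension y Hy) as (E0 & _ & E2 & _). rewrite E0, E2 in *. field. auto.
Qed.

Section Fixed_parameters.
Variables (alpha : R) (c : C) (d : R).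
Hypothesis alpha_pos : 0 < alpha.
Hypothesis d_pos : 0 < d.
Hypothesis d_min : forall y, 0 <= y -> d <= Cmod (speed c y).

Let A : R := speed_max c * K.
Let Lam : R := 4 * alpha * A * / d ^ 2 / eta ^ 2.

Lemma speed_nonzero (y : R) : 0 <= y -> speed c y <> RtoC 0.
Proof. intros Hy. apply Cmod_gt_0. pose proof (d_min y Hy). lra. Qed.

Lemma inverse_bound (y : R) : 0 <= y -> Cmod (/ speed c y) <= / d.
Proof.
  intros Hy. rewrite Cmod_inv by now apply speed_nonzero.
  apply Rinv_le_contravar; auto.
Qed.

Lemma potential_bounded :
  continuous_Rplus (potential alpha c) /\
  forall y, 0 <= y -> Cmod (potential alpha c y) <= alpha ^ 2 + K * / d.
Proof.
  split.
  - apply continuous_Rplus_of_continuous. intros y Hy.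
    apply (continuous_plus (V := C_R_NormedModule)); [apply continuous_const |].
    apply continuous_C_mult.
    + apply continuous_C_RtoC. now apply extension.
    + eapply is_derive_C_continuous, is_derive_C_inv;
        [now apply speed_derive | now apply speed_nonzero].
  - intros y Hy. unfold potential. eapply Rle_trans; [apply Cmod_triangle |].
    apply Rplus_le_compat.
    + rewrite Cmod_pow, Cmod_R, Rabs_pos_eq; lra.
    + rewrite Cmod_mult, Cmod_R. apply Rmult_le_compat; auto using Rabs_pos, Cmod_ge_0.
      * destruct (extension y Hy) as (_ & _ & -> & _).
        destruct (decay y Hy) as (_ & _ & H). pose proof (exp_decay_le_1 y Hy).
        pose proof K_pos. nra.
      * now apply inverse_bound.
Qed.

Lemma Jost_factor :
  exists m n : R -> C,
    (forall y, 0 <= y -> is_derive_C m y (/ (speed c y * speed c y) * n y)%C) /\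
    (forall y, 0 <= y ->
       is_derive_C n y (RtoC (2 * alpha) * (n y + speed c y * RtoC (V1 y) * m y))%C) /\
    (forall y, 0 <= y -> Cmod (m y - RtoC 1) <= Lam * exp Lam * exp (- eta * y)) /\
    (forall y, 0 <= y ->
       Cmod (n y) <= 4 * alpha * (A / eta) * exp Lam * exp (- eta * y)).
Proof.
  assert (S : forall y, 0 <= y ->
    is_derive_C (fun z => speed c z * speed c z)%C y
      (RtoC (V1 y) * speed c y + speed c y * RtoC (V1 y))%C).
  { intros y Hy. apply is_derive_C_mult; now apply speed_derive. }
  apply (Jost_solution alpha eta A (/ d ^ 2)
    (fun y => speed c y * RtoC (V1 y))%C (fun y => / (speed c y * speed c y))%C); auto.
  - apply Rlt_le, Rinv_0_lt_compat, pow_lt; auto.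
  - apply continuous_Rplus_of_continuous. intros y Hy. apply continuous_C_mult.
    + eapply is_derive_C_continuous. now apply speed_derive.
    + apply continuous_C_RtoC. destruct (extension y Hy) as (_ & _ & _ & _ & D & _).
      apply (ex_derive_continuous (V := R_NormedModule)). now exists (V2 y).
  - apply continuous_Rplus_of_continuous. intros y Hy.
    eapply is_derive_C_continuous, is_derive_C_inv; [now apply S |].
    apply Cmult_neq_0; now apply speed_nonzero.
  - intros y Hy. rewrite Cmod_mult, Cmod_R. unfold A. rewrite Rmult_assoc.
    apply Rmult_le_compat; auto using Cmod_ge_0, Rabs_pos, speed_le_max.
    destruct (extension y Hy) as (_ & -> & _). now apply decay.
  - intros y Hy. rewrite Cmod_inv by (apply Cmult_neq_0; now apply speed_nonzero).
    rewrite Cmod_mult. pose proof (d_min y Hy).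
    apply Rinv_le_contravar; [apply pow_lt; auto |]. simpl. rewrite Rmult_1_r.
    apply Rmult_le_compat; lra.
Qed.

Definition decaying (m : R -> C) (y : R) : C :=
  (speed c y * RtoC (exp (- alpha * y)) * m y)%C.
Definition decaying_slope (m n : R -> C) (y : R) : C :=
  (RtoC (exp (- alpha * y)) *
     ((RtoC (V1 y) - RtoC alpha * speed c y) * m y + n y * / speed c y))%C.

Lemma decaying_solves (m n : R -> C) :
  (forall y, 0 <= y -> is_derive_C m y (/ (speed c y * speed c y) * n y)%C) ->
  (forall y, 0 <= y ->
     is_derive_C n y (RtoC (2 * alpha) * (n y + speed c y * RtoC (V1 y) * m y))%C) ->
  solves (potential alpha c) (decaying m) (decaying_slope m n).
Proof.
  intros Hm Hn y Hy. pose proof (speed_nonzero y Hy).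
  pose proof (speed_derive c y Hy) as DF. specialize (Hm y Hy). specialize (Hn y Hy).
  destruct (extension y Hy) as (_ & _ & _ & _ & D1 & _).
  apply is_derive_C_RtoC in D1. split.
  - unfold decaying, decaying_slope. eapply is_derive_C_eq.
    + apply is_derive_C_mult; [| exact Hm].
      apply is_derive_C_mult; [exact DF | apply is_derive_C_exp].
    + cbv beta. rewrite RtoC_opp. field. auto.
  - unfold decaying, decaying_slope, potential. eapply is_derive_C_eq.
    + apply is_derive_C_mult; [apply is_derive_C_exp |]. apply is_derive_C_plus.
      * apply is_derive_C_mult; [| exact Hm]. apply is_derive_C_minus; [exact D1 |].
        apply is_derive_C_mult; [apply is_derive_C_const | exact DF].
      * apply is_derive_C_mult; [exact Hn |]. now apply is_derive_C_inv; [exact DF |].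
    + cbv beta. rewrite RtoC_opp, RtoC_mult. field. auto.
Qed.

(** [m] is within [1 / 2] of [1] for large [y]. *)
Lemma decaying_bounds (m : R -> C) (s : R) :
  (forall y, 0 <= y -> Cmod (m y - RtoC 1) <= s * exp (- eta * y)) ->
  exists Y, 0 <= Y /\ forall y, Y <= y ->
    d / 2 * exp (- alpha * y) <= Cmod (decaying m y)
      <= speed_max c * (3 / 2) * exp (- alpha * y).
Proof.
  intros Hm. destruct (exp_decay_small s eta (/ 2) 0 eta_pos ltac:(lra)) as [Y [_ [HY SY]]].
  exists Y. split; auto. intros y Hy.
  assert (Hy0 : 0 <= y) by lra.
  assert (M : Cmod (m y - RtoC 1) <= / 2).
  { eapply Rle_trans; [now apply Hm |].
    assert (0 <= s).
    { pose proof (Hm 0 (Rle_refl 0)) as H. rewrite Rmult_0_r, exp_0, Rmult_1_r in H.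
      pose proof (Cmod_ge_0 (m 0 - RtoC 1)); lra. }
    assert (exp (- eta * y) <= exp (- eta * Y)) by (apply exp_le; nra). nra. }
  pose proof (Cmod_triangle (m y - RtoC 1) (RtoC 1)) as T1.
  replace (m y - RtoC 1 + RtoC 1)%C with (m y) in T1 by ring.
  pose proof (Cmod_triangle (RtoC 1 - m y) (m y)) as T2.
  replace (RtoC 1 - m y + m y)%C with (RtoC 1) in T2 by ring.
  rewrite Cmod_minus_sym in T2. rewrite Cmod_1 in T1, T2.
  unfold decaying. rewrite !Cmod_mult, Cmod_exp.
  pose proof (d_min y Hy0). pose proof (speed_le_max c y Hy0).
  pose proof (exp_pos (- alpha * y)) as P. split.
  - replace (d / 2 * exp (- alpha * y)) with (d * exp (- alpha * y) * / 2) by field.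
    apply Rmult_le_compat; try lra.
    + apply Rmult_le_pos; lra.
    + apply Rmult_le_compat_r; lra.
  - replace (speed_max c * (3 / 2) * exp (- alpha * y))
      with (speed_max c * exp (- alpha * y) * (3 / 2)) by ring.
    apply Rmult_le_compat; auto using Cmod_ge_0.
    + apply Rmult_le_pos; [apply Cmod_ge_0 | lra].
    + apply Rmult_le_compat_r; lra.
    + lra.
Qed.

Lemma growing_partner (m n : R -> C) (s : R) :
  solves (potential alpha c) (decaying m) (decaying_slope m n) ->
  (forall y, 0 <= y -> Cmod (m y - RtoC 1) <= s * exp (- eta * y)) ->
  bigO_infty (decaying m) (fun y => exp (- Rabs alpha * y)) /\
  exists g dg, solves (potential alpha c) g dg /\
    (forall y, 0 <= y -> Wronskian (decaying m) (decaying_slope m n) g dg y = RtoC 1) /\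
    bigO_infty g (fun y => exp (Rabs alpha * y)).
Proof.
  intros Sm Hm. destruct (decaying_bounds m s Hm) as [Y [HY HB]].
  unfold bigO_infty. rewrite !Rabs_pos_eq by lra. split.
  - exists (speed_max c * (3 / 2)), Y. intros y Hy. apply HB; lra.
  - destruct potential_bounded as [Qc Qb].
    destruct (unit_Wronskian_partner _ _ _ _ Y Qc Qb Sm HY) as (g & dg & Sg & W).
    { apply Cmod_gt_0. destruct (HB Y (Rle_refl Y)) as [H _].
      pose proof (exp_pos (- alpha * Y)). nra. }
    exists g, dg. split; [auto | split; [auto |]].
    destruct (partner_growth (decaying m) (decaying_slope m n) g dg alpha (d / 2)
      (speed_max c * (3 / 2)) Y) as [M HM]; auto; try lra.
    + intros y Hy. now apply Sm.
    + intros y Hy. now apply Sg.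
    + exists M, Y. intros y Hy. apply HM; lra.
Qed.

End Fixed_parameters.

Lemma Omega0_integral (c : C) (d : R) :
  0 < d -> (forall y, 0 <= y -> d <= Cmod (speed c y)) ->
  is_RInt_gen (V := C_R_NormedModule) (Omega0_integrand Us Uplus c)
    (at_point 0) (Rbar_locally p_infty)
    (tail (Omega_profile (speed c) (RtoC Uplus - c)%C) 0).
Proof.
  intros Hd Hc.
  assert (B : d <= Cmod (RtoC Uplus - c) <= speed_max c).
  { split; [now apply limit_speed_min | apply limit_speed_max]. }
  assert (B' : forall y, 0 <= y -> d <= Cmod (speed c y) <= speed_max c).
  { intros y Hy. split; auto using speed_le_max. }
  apply (is_RInt_gen_ext (V := C_R_NormedModule)
    (Omega_profile (speed c) (RtoC Uplus - c)%C)).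
  - exists (fun a => a = 0) (fun b => 0 < b); [reflexivity | now exists 0 |].
    intros a b -> Hb x Hx. simpl in Hx. rewrite Rmin_left in Hx by lra.
    unfold Omega_profile, Omega0_integrand, speed.
    now destruct (extension x ltac:(lra)) as [-> _].
  - refine (proj1 (tail_bound _ (profile_bound K d (speed_max c) / d ^ 2) eta eta_pos _ _)).
    + apply (Omega_profile_cont d (speed_max c) _ (fun y => RtoC (V1 y))); auto.
      apply speed_derive.
    + apply (Omega_profile_decay eta K d (speed_max c)); auto.
      apply speed_limit.
Qed.

Definition unit_speed_max : R := Rabs Uplus + K + 1.
(** The factor [12 = 4 * 3] comes from [exp L <= 3] in the bound on the flux. *)
Definition flux_bound : R := 12 * (unit_speed_max * K) / eta.
(** Below this value the constant [L] of the weight is at most [1 / 6], hence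
    [|m - 1| <= L exp L <= 1 / 2]. *)
Definition alpha_max (delta : R) : R :=
  Rmin 1 (eta ^ 2 * delta ^ 2 / (24 * (unit_speed_max * K) + 24)).
Definition remainder_bound (delta : R) : R :=
  expansion_bound eta K delta unit_speed_max flux_bound.

Lemma alpha_max_bounds (delta : R) : 0 < delta -> 0 < alpha_max delta <= 1.
Proof.
  intros Hd. unfold alpha_max. split; [| apply Rmin_l].
  apply Rmin_glb_lt; [lra |]. apply Rdiv_lt_0_compat.
  - apply Rmult_lt_0_compat; apply pow_lt; auto.
  - pose proof K_pos. unfold unit_speed_max. pose proof (Rabs_pos Uplus). nra.
Qed.

Lemma decaying_expansion (alpha : R) (c : C) (d delta : R) (m n : R -> C) :
  Us 0 = 0 -> 0 < alpha -> 0 < delta <= d ->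
  (forall y, 0 <= y -> d <= Cmod (speed c y)) ->
  (forall y, 0 <= y -> is_derive_C m y (/ (speed c y * speed c y) * n y)%C) ->
  (forall y, 0 <= y ->
     is_derive_C n y (RtoC (2 * alpha) * (n y + speed c y * RtoC (V1 y) * m y))%C) ->
  (let L := 4 * alpha * (speed_max c * K) * / d ^ 2 / eta ^ 2 in
   (forall y, 0 <= y -> Cmod (m y - RtoC 1) <= L * exp L * exp (- eta * y)) /\
   (forall y, 0 <= y ->
      Cmod (n y) <= 4 * alpha * (speed_max c * K / eta) * exp L * exp (- eta * y))) ->
  alpha < alpha_max delta -> Cmod c < 1 -> c <> RtoC 0 ->
  decaying alpha c m 0 <> RtoC 0 /\
  Cmod (decaying_slope alpha c m n 0 / decaying alpha c m 0
        - log_derivative_expansion Us dU Uplus alpha c)%C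
    <= remainder_bound delta * (alpha ^ 3 / Cmod c ^ 2).
Proof.
  intros U0 Ha Hdelta Hd Hm Hn [Bm Bn] Hsmall Hc Nc.
  set (L := 4 * alpha * (speed_max c * K) * / d ^ 2 / eta ^ 2) in *.
  pose proof K_pos as K0. pose proof (Rabs_pos Uplus) as U1. pose proof (Cmod_ge_0 c) as C1.
  assert (SM : 0 <= speed_max c * K <= unit_speed_max * K).
  { unfold speed_max, unit_speed_max. split; [nra |]. apply Rmult_le_compat_r; lra. }
  assert (e2 : 0 < eta ^ 2) by (apply pow_lt; auto).
  assert (dd : 0 < delta ^ 2 <= d ^ 2).
  { split; [apply pow_lt; lra | apply pow_incr; lra]. }
  assert (L6 : 0 <= L <= / 6).
  { assert (Hs : alpha * (24 * (unit_speed_max * K) + 24) <= eta ^ 2 * delta ^ 2).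
    { assert (H : alpha <= eta ^ 2 * delta ^ 2 / (24 * (unit_speed_max * K) + 24)).
      { eapply Rle_trans; [apply Rlt_le, Hsmall | apply Rmin_r]. }
      apply (Rmult_le_compat_r (24 * (unit_speed_max * K) + 24)) in H; [| lra].
      replace (eta ^ 2 * delta ^ 2 / (24 * (unit_speed_max * K) + 24)
                 * (24 * (unit_speed_max * K) + 24)) with (eta ^ 2 * delta ^ 2) in H
        by (field; lra). lra. }
    assert (EL : L * (d ^ 2 * eta ^ 2) = 4 * alpha * (speed_max c * K))
      by (unfold L; field; lra).
    assert (P : 0 < d ^ 2 * eta ^ 2) by (apply Rmult_lt_0_compat; lra).
    assert (0 <= alpha * (speed_max c * K)) by (apply Rmult_le_pos; lra).
    assert (alpha * (speed_max c * K) <= alpha * (unit_speed_max * K))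
      by (apply Rmult_le_compat_l; lra).
    assert (eta ^ 2 * delta ^ 2 <= d ^ 2 * eta ^ 2) by nra.
    split; nra. }
  assert (eL : exp L <= 3).
  { eapply Rle_trans; [| apply exp_le_3]. apply exp_le. lra. }
  assert (mL : forall y, 0 <= y -> / 2 <= Cmod (m y)).
  { intros y Hy. pose proof (exp_decay_le_1 y Hy). pose proof (exp_pos L).
    pose proof (Bm y Hy) as B1.
    assert (L * exp L <= / 2) by nra.
    assert (0 <= L * exp L) by nra.
    assert (Cmod (m y - RtoC 1) <= / 2) by nra.
    pose proof (Cmod_triangle (RtoC 1 - m y) (m y)) as T2.
    replace (RtoC 1 - m y + m y)%C with (RtoC 1) in T2 by ring.
    rewrite Cmod_minus_sym, Cmod_1 in T2. lra. }
  assert (nL : forall y, 0 <= y -> Cmod (n y) <= flux_bound * alpha * exp (- eta * y)).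
  { intros y Hy. eapply Rle_trans; [now apply Bn |].
    apply Rmult_le_compat_r; [apply Rlt_le, exp_pos |].
    unfold flux_bound.
    replace (12 * (unit_speed_max * K) / eta * alpha)
      with (4 * alpha * (unit_speed_max * K / eta) * 3) by (field; lra).
    assert (IE : 0 < / eta) by now apply Rinv_0_lt_compat.
    apply Rmult_le_compat; try lra.
    - apply Rmult_le_pos; [lra |]. apply Rmult_le_pos; lra.
    - apply Rlt_le, exp_pos.
    - apply Rmult_le_compat_l; [lra |]. apply Rmult_le_compat_r; lra. }
  assert (SD : speed_max c <= unit_speed_max) by (unfold speed_max, unit_speed_max; lra).
  assert (EX := defect_second_order alpha eta K delta unit_speed_max flux_bound
    (speed c) (fun y => RtoC (V1 y)) m n (RtoC Uplus - c)%C Ha eta_pos (proj1 Hdelta)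
    (speed_derive c)).
  assert (EX' : Cmod (Riccati_defect alpha (speed c) m n (RtoC Uplus - c)%C 0
      + RtoC alpha * (RtoC Uplus - c) ^ 2
          * tail (Omega_profile (speed c) (RtoC Uplus - c)%C) 0)
      <= remainder_bound delta * alpha ^ 2).
  { apply EX; auto.
    - intros y Hy. pose proof (Hd y Hy). pose proof (speed_le_max c y Hy). lra.
    - pose proof (limit_speed_min c d Hd). pose proof (limit_speed_max c). lra.
    - apply speed_limit. }
  clear EX.
  assert (Om : Omega0_at_0 Us Uplus c = (- (RtoC 1 / (RtoC Uplus - c) ^ 2)
    * tail (Omega_profile (speed c) (RtoC Uplus - c)%C) 0)%C).
  { unfold Omega0_at_0. f_equal.
    apply (is_RInt_gen_unique (V := C_R_CompleteNormedModule)
      (FFb := at_infinity_proper)).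
    apply (Omega0_integral c d); auto; lra. }
  assert (Np : (RtoC Uplus - c)%C <> RtoC 0).
  { apply Cmod_gt_0. pose proof (limit_speed_min c d Hd). lra. }
  assert (Nm : m 0 <> RtoC 0).
  { apply Cmod_gt_0. pose proof (mL 0 (Rle_refl 0)). lra. }
  assert (Nal : RtoC alpha <> RtoC 0) by (intros E; apply RtoC_inj in E; lra).
  assert (F0 : speed c 0 = (- c)%C).
  { unfold speed. destruct (extension 0 (Rle_refl 0)) as [-> _]. rewrite U0. ring. }
  assert (E0 : RtoC (exp (- alpha * 0)) = RtoC 1) by now rewrite Rmult_0_r, exp_0.
  assert (V10 : V1 0 = dU 1%nat 0) by (apply extension; lra).
  unfold decaying, decaying_slope. rewrite F0, E0, V10. split.
  - replace (- c * RtoC 1 * m 0)%C with (- (c * m 0))%C by ring.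
    intros E. apply (Cmult_neq_0 c (m 0) Nc Nm).
    replace (c * m 0)%C with (- - (c * m 0))%C by ring. rewrite E. ring.
  - unfold log_derivative_expansion. rewrite Om.
    unfold Riccati_defect in EX'. rewrite F0 in EX'.
    match type of EX' with Cmod ?z <= _ => set (rem := z) in * end.
    match goal with |- Cmod ?z <= _ => replace z with (RtoC alpha / c ^ 2 * rem)%C end.
    + assert (C2 : 0 < Cmod c ^ 2) by (apply pow_lt, Cmod_gt_0; auto).
      rewrite Cmod_mult, Cmod_div, Cmod_pow, Cmod_R, Rabs_pos_eq by (lra || now apply Cpow_nz).
      replace (remainder_bound delta * (alpha ^ 3 / Cmod c ^ 2))
        with (alpha / Cmod c ^ 2 * (remainder_bound delta * alpha ^ 2))
        by (unfold Rdiv; ring).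
      apply Rmult_le_compat_l; auto.
      apply Rmult_le_pos; [lra | now apply Rlt_le, Rinv_0_lt_compat].
    + unfold rem. set (T := tail _ 0). field. auto.
Qed.

End Rayleigh.

(** A positive lower bound exists by compactness of bounded intervals and because
    the limit [Uplus] differs from [c]. The greatest one is taken: the bounds on the
    solutions for [c] are in terms of [d], and the expansion has to hold for every
    lower bound [delta] with constants independent of [c]. *)
Lemma distance_to_range (Us V0 : R -> R) (Uplus K eta : R) (c : C) :
  0 < eta ->
  (forall y, 0 <= y -> V0 y = Us y /\ ex_derive V0 y) ->
  (forall y, 0 <= y -> Rabs (Us y - Uplus) <= K * exp (- eta * y)) ->
  admissible Us Uplus c ->
  exists d, 0 < d /\ (forall y, 0 <= y -> d <= Cmod (RtoC (V0 y) - c)) /\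
    forall delta, (forall z, 0 <= z -> delta <= Cmod (RtoC (Us z) - c)) -> delta <= d.
Proof.
  intros He HV HK (_ & Np & Nz).
  set (E := fun d => forall z, 0 <= z -> d <= Cmod (RtoC (Us z) - c)).
  assert (P : exists d, 0 < d /\ E d).
  { set (g := Cmod (RtoC Uplus - c)).
    assert (g0 : 0 < g).
    { apply Cmod_gt_0. intros Z. apply Np.
      replace c with (RtoC Uplus - (RtoC Uplus - c))%C by ring. rewrite Z. ring. }
    destruct (exp_decay_small K eta (g / 2) 0 He ltac:(lra)) as [Y [_ [HY SY]]].
    set (h := fun y => Cmod (RtoC (V0 y) - c)).
    destruct (continuity_ab_min h 0 Y HY) as [x [Hx Hx0]].
    { intros y Hy. apply continuity_pt_filterlim.
      apply (continuous_ext (fun y => norm (V := C_R_NormedModule) (RtoC (V0 y) - c)%C)).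
      { intros t. symmetry. apply Cmod_norm. }
      apply (continuous_comp (fun y => (RtoC (V0 y) - c)%C : C_R_NormedModule)
        (norm (V := C_R_NormedModule))).
      - apply (continuous_minus (V := C_R_NormedModule)); [| apply continuous_const].
        apply continuous_C_pair; [| apply continuous_const].
        apply (ex_derive_continuous (V := R_NormedModule)). now apply HV.
      - apply filterlim_norm. }
    assert (x0 : 0 < h x).
    { apply Cmod_gt_0. destruct (HV x ltac:(lra)) as [-> _]. intros Z.
      apply (Nz x ltac:(lra)).
      replace (RtoC (Us x)) with (RtoC (Us x) - c + c)%C by ring. rewrite Z. ring. }
    exists (Rmin (h x) (g / 2)). split; [apply Rmin_glb_lt; lra |].
    intros z Hz. destruct (Rle_dec z Y) as [L | L].
    - eapply Rle_trans; [apply Rmin_l |]. destruct (HV z Hz) as [<- _]. apply Hx. lra.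
    - eapply Rle_trans; [apply Rmin_r |].
      assert (B : Cmod (RtoC Uplus - RtoC (Us z)) <= g / 2).
      { rewrite <- RtoC_minus, Cmod_R, Rabs_minus_sym.
        eapply Rle_trans; [now apply HK |].
        assert (exp (- eta * z) <= exp (- eta * Y)) by (apply exp_le; nra).
        assert (0 <= K).
        { pose proof (HK 0 (Rle_refl 0)) as H1.
          rewrite Rmult_0_r, exp_0, Rmult_1_r in H1.
          pose proof (Rabs_pos (Us 0 - Uplus)). lra. }
        nra. }
      pose proof (Cmod_triangle_minus (RtoC Uplus) (RtoC (Us z)) c) as T.
      fold g in T. lra. }
  destruct P as [d0 [Hd0 Ed0]].
  destruct (completeness E) as [d [Ub Lub]].
  - exists (Cmod (RtoC (Us 0) - c)). intros x Hx. apply Hx. lra.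
  - now exists d0.
  - exists d. split; [apply Rlt_le_trans with d0; [auto | now apply Ub] |]. split.
    + intros y Hy. destruct (HV y Hy) as [-> _]. apply Lub. intros x Hx. now apply Hx.
    + intros delta H. now apply Ub.
Qed.

(** * Choice of the solutions *)

(* The remainder is O(alpha^3/c^2) locally uniformly in c: the constants may
   depend on a lower bound delta for the distance from c to the range of Us.
   They cannot be uniform as c tends to that range, which contains Us 0 = 0. *)
Theorem theorem1p3 (Us : R -> R) (dU : nat -> R -> R) (Uplus : R)
  (HU : shear_profile Us dU Uplus) :
  exists (alpha0 : R) (psip dpsip psim dpsim : R -> C -> R -> C),
    0 < alpha0 /\
    (forall (alpha : R) (c : C),
       0 < alpha < alpha0 -> admissible Us Uplus c ->
       Rayleigh_solution Us dU alpha c (psip alpha c) (dpsip alpha c) /\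
       Rayleigh_solution Us dU alpha c (psim alpha c) (dpsim alpha c) /\
       independent_Rplus (psip alpha c) (psim alpha c) /\
       (forall y, 0 <= y ->
          Wronskian (psim alpha c) (dpsim alpha c)
                    (psip alpha c) (dpsip alpha c) y = RtoC 1) /\
       bigO_infty (psip alpha c) (fun y => exp (Rabs alpha * y)) /\
       bigO_infty (psim alpha c) (fun y => exp (- Rabs alpha * y))) /\
    (exists c0 : R, 0 < c0 /\
       (forall c : C, Cmod c < c0 -> admissible Us Uplus c ->
          Omega0_integrable Us Uplus c) /\
       forall delta : R, 0 < delta ->
       exists alpha1 K : R, 0 < alpha1 <= alpha0 /\
       forall (alpha : R) (c : C),
         0 < alpha < alpha1 -> Cmod c < c0 -> admissible Us Uplus c ->
         (forall z, 0 <= z -> delta <= Cmod (RtoC (Us z) - c)%C) ->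
         psim alpha c 0 <> RtoC 0 /\
         Cmod (dpsim alpha c 0 / psim alpha c 0
               - log_derivative_expansion Us dU Uplus alpha c)%C
           <= K * (alpha ^ 3 / Cmod c ^ 2)).
Proof.
  destruct HU as [Hsm U0 [K [eta [eta_pos decay]]]].
  destruct (profile_extension Us dU Hsm) as (V0 & V1 & V2 & ext).
  assert (Dist := fun c => distance_to_range Us V0 Uplus K eta c eta_pos
    (fun y Hy => conj (proj1 (ext y Hy))
       (ex_intro _ (V1 y) (proj1 (proj2 (proj2 (proj2 (ext y Hy)))))))
    (fun y Hy => proj1 (decay y Hy))).
  assert (Sol : forall p : R * C, exists q : (R -> C) * (R -> C) * ((R -> C) * (R -> C)),
    0 < fst p -> admissible Us Uplus (snd p) ->
    let '(alpha, c) := p in let '(f, df, (g, dg)) := q in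
    (Rayleigh_solution Us dU alpha c f df /\ Rayleigh_solution Us dU alpha c g dg /\
     independent_Rplus f g /\
     (forall y, 0 <= y -> Wronskian g dg f df y = RtoC 1) /\
     bigO_infty f (fun y => exp (Rabs alpha * y)) /\
     bigO_infty g (fun y => exp (- Rabs alpha * y))) /\
    forall delta, 0 < delta -> alpha < alpha_max Uplus K eta delta -> Cmod c < 1 ->
      (forall z, 0 <= z -> delta <= Cmod (RtoC (Us z) - c)%C) ->
      g 0 <> RtoC 0 /\
      Cmod (dg 0 / g 0 - log_derivative_expansion Us dU Uplus alpha c)%C
        <= remainder_bound Uplus K eta delta * (alpha ^ 3 / Cmod c ^ 2)).
  (* outside the parameter range the choice is immaterial: zero functions *)
  { intros [alpha c].
    destruct (classic (0 < alpha /\ admissible Us Uplus c)) as [[Ha Hc] | No];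
      [| exists ((fun _ => RtoC 0, fun _ => RtoC 0), (fun _ => RtoC 0, fun _ => RtoC 0));
         simpl; intros H1 H2; exfalso; now apply No].
    destruct (Dist c Hc) as [d [Hd [Hdmin Hdmax]]].
    destruct (Jost_factor Us dU Uplus K eta V0 V1 V2 eta_pos ext decay alpha c d Ha Hd Hdmin)
      as (m & n & Hm & Hn & Bm & Bn).
    pose proof (decaying_solves Us dU V0 V1 V2 ext alpha c d Hd Hdmin m n Hm Hn) as Sg.
    destruct (growing_partner Us dU Uplus K eta V0 V1 V2 eta_pos ext decay alpha c d Ha Hd
      Hdmin m n _ Sg Bm) as (Og & f & df & Sf & W & Of).
    exists ((f, df), (decaying V0 alpha c m, decaying_slope V0 V1 alpha c m n)).
    intros _ _. simpl in Hdmin.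
    assert (NZ : forall y, 0 <= y -> speed V0 c y <> RtoC 0).
    { intros y Hy. exact (speed_nonzero V0 c d Hd Hdmin y Hy). }
    split; [split; [| split; [| split; [| split; [| split]]]] |].
    - now apply (Rayleigh_of_solves Us dU V0 V1 V2 ext).
    - now apply (Rayleigh_of_solves Us dU V0 V1 V2 ext).
    - apply (Wronskian_one_independent f df (decaying V0 alpha c m)
        (decaying_slope V0 V1 alpha c m n)); auto.
      + intros y Hy. now apply Sf.
      + intros y Hy. now apply Sg.
    - auto.
    - auto.
    - auto.
    - intros delta Hdelta Hsmall Hc1 Hrange.
      apply (decaying_expansion Us dU Uplus K eta V0 V1 V2 eta_pos ext decay alpha c d delta);
        auto. apply Hc. }
  destruct (functional_choice _ Sol) as [S HS].
  exists 1, (fun alpha c => fst (fst (S (alpha, c)))), (fun alpha c => snd (fst (S (alpha, c)))),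
    (fun alpha c => fst (snd (S (alpha, c)))), (fun alpha c => snd (snd (S (alpha, c)))).
  split; [lra | split].
  - intros alpha c [Ha _] Hc. specialize (HS (alpha, c) Ha Hc).
    destruct (S (alpha, c)) as [[f df] [g dg]]. apply HS.
  - exists 1. split; [lra | split].
    + intros c _ Hc. destruct (Dist c Hc) as [d [Hd [Hdmin _]]].
      eexists. now apply (Omega0_integral Us dU Uplus K eta V0 V1 V2 eta_pos ext decay c d).
    + intros delta Hdelta.
      exists (alpha_max Uplus K eta delta), (remainder_bound Uplus K eta delta).
      split; [now apply (alpha_max_bounds Us dU Uplus K eta eta_pos decay) |].
      intros alpha c [Ha Hsmall] Hc1 Hc Hrange. specialize (HS (alpha, c) Ha Hc).
      destruct (S (alpha, c)) as [[f df] [g dg]]. now apply HS.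
Qed.
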